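(* There exists a constant $C>0$, independent of $N$, such that for every integer $N\geq 1$, $$\operatorname{Var}\big(F_N(1)\big)\leq \frac14\log N + C,$$ where $F_N(1)$ is the free energy of the Sherrington--Kirkpatrick model on $N$ spins (zero external field) at inverse temperature $\beta=1$.
   Context: For an integer $N\ge 1$, let $(g_{ij})_{1\le i<j\le N}$ be independent centered real Gaussian random variables of variance $1/N$; probability, expectation $\mathbb E$ and variance $\operatorname{Var}$ are with respect to these variables. For $\sigma=(\sigma_1,\ldots,\sigma_N)\in\{-1,1\}^N$ define the Sherrington--Kirkpatrick Hamiltonian $H_N(\sigma)=\sum_{1\le i<j\le N} g_{ij}\sigma_i\sigma_j$. For $\beta\ge 0$ the partition function and free energy are $$Z_N(\beta)=\frac1{2^N}\sum_{\sigma\in\{-1,1\}^N}e^{\beta H_N(\sigma)},\qquad F_N(\beta)=\log Z_N(\beta).$$ *)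

(* Defs.v *)
From mathcomp Require Import all_boot all_order all_algebra.
From mathcomp Require Import all_classical all_reals all_analysis.

Set Implicit Arguments.
Unset Strict Implicit.
Unset Printing Implicit Defensive.

Import Order.TTheory GRing.Theory Num.Theory.
Import numFieldNormedType.Exports.

Local Open Scope classical_set_scope.
Local Open Scope ring_scope.

Definition mutually_independent (R : realType) (d : measure_display)
    (T : measurableType d) (P : probability T R) (I : finType)
    (X : I -> {RV P >-> R}) : Prop :=
  forall (J : {set I}) (A : I -> set R), (forall i, measurable (A i)) ->
    P (\bigcap_(i in [set` J]) (X i @^-1` A i)) =
    (\prod_(i in J) P (X i @^-1` A i))%E.

(* [normal_prob] is parametrized by the standard deviation. It is a genuine
   measure only on measurable sets, so equality in law is tested on those. For
   [v = 0] it would not be the Dirac mass, so [v] must be positive. *)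
Definition centered_gaussian (R : realType) (d : measure_display)
    (T : measurableType d) (P : probability T R) (v : R)
    (X : {RV P >-> R}) : Prop :=
  forall A : set R, measurable A ->
    distribution P X A = normal_prob 0 (Num.sqrt v) A.

Definition edge (N : nat) : finType := {p : 'I_N * 'I_N | (p.1 < p.2)%N}.

(* The configuration space {-1,1}^N is encoded by {ffun 'I_N -> bool}, with
   [false] standing for the spin 1 and [true] for the spin -1. *)
Definition spin (R : realType) (b : bool) : R := (-1) ^+ b.

Definition hamiltonian (R : realType) (N : nat) (g : edge N -> R)
    (s : {ffun 'I_N -> bool}) : R :=
  \sum_(e : edge N) g e * spin R (s (val e).1) * spin R (s (val e).2).

Definition partition_function (R : realType) (N : nat) (beta : R)
    (g : edge N -> R) : R :=
  (2 ^+ N)^-1 * \sum_(s : {ffun 'I_N -> bool}) expR (beta * hamiltonian g s).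

Definition free_energy (R : realType) (N : nat) (beta : R)
    (g : edge N -> R) : R :=
  ln (partition_function beta g).

(* Main.v *)
(* If F is convex and g is a Gaussian vector with covariance s^2 Id, then
   r |-> ln (E exp (r F(g))) / r is convex; comparing its slope at 0 with its
   values gives Var F <= 2 (ln E Z - E ln Z) for F = ln Z, and comparing r = 1
   with r = 2 bounds the annealed gap by ln (E Z^2 / (E Z)^2) / 2. The convexity
   comes from the variational formula
     ln E exp (r F(g)) / r = sup_a E (F (g + r s^2 a) - r s^2 |a|^2 / 2)
   over adapted drifts a. Here it is discretized: the couplings are integrated
   out one at a time with explicit drifts, and each of the at most N^2 couplings,
   of variance s^2 = 1/N, contributes an error O(s^4). Finally
   E Z^2 / (E Z)^2 is at most E exp (S^2 / (2N)) with S a sum of N random signs;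
   linearizing the square and using cosh y <= exp ((1 - h) y^2 / 2 + 3 h^2) with
   h of order N^(-1/2) bounds it by a multiple of N^(1/4). *)
Require Import Defs.
From HB Require Import structures.
From mathcomp Require Import all_boot all_order all_algebra.
From mathcomp Require Import all_classical all_reals all_analysis.
From mathcomp Require Import measurable_realfun ring lra.

Set Implicit Arguments.
Unset Strict Implicit.
Unset Printing Implicit Defensive.

Import Order.TTheory GRing.Theory Num.Theory.
Import numFieldNormedType.Exports.

Local Open Scope classical_set_scope.
Local Open Scope ring_scope.

(** * Gaussian integrals *)

(** There can be of order N^2 couplings while s^4 = N^-2, so no more than O(s^4) may be lost per
    coupling: losses of order s^3 would add up to a power of N. Two facts remove the odd orders. The
    law of a coupling is symmetric, so only even parts in t survive integration; and the slope along
    an edge is a sign, so the dependence on one coupling is that of tanh (t + const), with error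
    constants uniform in all the other couplings. This uniformity lets the one-variable bounds pass
    to averages over the couplings that are still random.

    Neither convexity comparison can be proved by induction at a single base point, because the
    drifts at r = 0, 1 and 2 differ and move the arguments apart. Both inductions over the set of
    random couplings therefore carry independent base points, one for the undrifted and one for the
    drifted couplings. With no random coupling left, each reduces to convexity of the log partition
    function; a step reveals one coupling and lets the drift cost cancel against the gain. *)

Section gaussian.
Context {R : realType}.
Implicit Types (s r t : R).

(** The Radon-Nikodym derivative agrees almost everywhere with [normal_pdf], since both have the
    same integral over every measurable set. *)
Lemma ge0_integral_normal_prob (m s : R) (f : R -> \bar R) :
  measurable_fun [set: R] f -> (forall x, 0 <= f x)%E ->
  (\int[normal_prob m s]_x f x =
   \int[lebesgue_measure]_x (f x * (normal_pdf m s x)%:E))%E.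
Proof.
move=> mf f0.
have dom := normal_prob_dominates m s.
rewrite -(Radon_Nikodym_SigmaFinite.change_of_variables dom f0 measurableT mf).
have int_pdf : lebesgue_measure.-integrable [set: R]
    (EFin \o normal_pdf m s) := integrable_normal_pdf m s.
have int_rn := Radon_Nikodym_SigmaFinite.f_integrable dom.
apply: ae_eq_integral => //.
- apply: emeasurable_funM => //; exact: measurable_int int_rn.
- apply: emeasurable_funM => //; exact: measurable_int int_pdf.
- apply: ae_eqe_mul2l; apply: integral_ae_eq => //.
  + exact: measurable_int int_pdf.
  + by move=> E _ mE; rewrite -Radon_Nikodym_SigmaFinite.f_integral.
Qed.

Lemma normal_pdf_peak (m s x : R) : s != 0 ->
  normal_pdf m s x = normal_peak s * normal_fun m s x.
Proof. by move=> s0; rewrite normal_pdfE. Qed.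

Lemma normal_mgf s r : s != 0 ->
  (\int[normal_prob 0 s]_x (expR (r * x))%:E = (expR (s ^+ 2 * r ^+ 2 / 2))%:E)%E.
Proof.
move=> s0; rewrite ge0_integral_normal_prob; last 2 first.
- by apply/measurable_EFinP; apply: measurableT_comp => //; exact: measurable_funM.
- by move=> x; rewrite lee_fin expR_ge0.
(* Completing the square: the tilted density is a constant times the Gaussian density of mean
   [s ^+ 2 * r]. *)
transitivity (\int[lebesgue_measure]_x ((expR (s ^+ 2 * r ^+ 2 / 2))%:E *
    (normal_pdf (s ^+ 2 * r) s x)%:E))%E.
  apply: eq_integral => x _; rewrite -!EFinM; congr EFin.
  rewrite !normal_pdf_peak// /normal_fun mulrCA [RHS]mulrCA -!expRD.
  by congr (_ * expR _); field.
rewrite integralZl//=; last exact: integrable_normal_pdf.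
by rewrite integral_normal_pdf mule1.
Qed.

Lemma ge0_integral_oppr (f : R -> \bar R) :
  measurable_fun [set: R] f -> (forall x, 0 <= f x)%E ->
  (\int[lebesgue_measure]_x f (- x)%R = \int[lebesgue_measure]_x f x)%E.
Proof.
move=> mf f0.
have := @ge0_integral_pushforward _ _ (measurableTypeR R) (measurableTypeR R) R
  -%R (@oppr_measurable R setT) lebesgue_measure setT f measurableT mf.
move=> /(_ _)/esym h; rewrite [LHS]h//.
by apply: eq_measure_integral => A mA _; exact: lebesgue_measureN.
Qed.

Lemma ge0_integral_normal_probN s (f : R -> \bar R) : s != 0 ->
  measurable_fun [set: R] f -> (forall x, 0 <= f x)%E ->
  (\int[normal_prob 0 s]_x f (- x)%R = \int[normal_prob 0 s]_x f x)%E.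
Proof.
move=> s0 mf f0.
rewrite !ge0_integral_normal_prob//; last exact: measurableT_comp.
rewrite -[RHS]ge0_integral_oppr.
- by apply: eq_integral => x _; rewrite !normal_pdf_peak// /normal_fun !subr0 sqrrN.
- apply: emeasurable_funM => //; apply/measurable_EFinP.
  exact: measurable_normal_pdf.
- by move=> x; rewrite mule_ge0 ?lee_fin ?normal_pdf_ge0.
Qed.

End gaussian.

(** * Elementary inequalities for the exponential *)

Section calculus.
Context {R : realType}.

Lemma mean_value0 (f df : R -> R) (a : R) :
  (forall x : R, is_derive x 1 f (df x)) ->
  exists2 c, `|c| <= `|a| & f a - f 0 = df c * a.
Proof.
move=> fdf.
have cf : continuous f.
  by move=> x; apply/differentiable_continuous/derivable1_diffP; case: (fdf x).
have [a0|a0] := leP 0 a.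
  have [c] := MVT_segment a0 (fun x _ => fdf x)
    (continuous_subspaceT cf).
  rewrite in_itv/= subr0 => /andP[c0 ca] h; exists c => //.
  by rewrite !ger0_norm.
have [c] := MVT_segment (ltW a0) (fun x _ => fdf x)
    (continuous_subspaceT cf).
rewrite in_itv/= sub0r => /andP[c0 ca] h; exists c => //.
  by rewrite (ler0_norm ca) (ltr0_norm a0) lerN2.
by rewrite -opprB h mulrN opprK.
Qed.

Lemma sinh_ge (y : R) : 0 <= y -> 2 * y <= expR y - expR (- y).
Proof.
move=> y0.
have [|c _] := @mean_value0 (fun x => expR x - expR (- x))
    (fun x => expR x + expR (- x)) y.
  by move=> x; apply: is_derive_eq; rewrite mulrN1 opprK.
rewrite oppr0 subrr subr0 => ->; rewrite ler_wpM2r//.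
have h := expR_gt0 c; rewrite expRN -subr_ge0.
have -> : expR c + (expR c)^-1 - 2 = (expR c - 1) ^+ 2 / expR c.
  by field; rewrite gt_eqF.
by rewrite divr_ge0 ?sqr_ge0// ltW.
Qed.

(** The right-hand side is the square of e^(x/2) - e^(-x/2). The constant 1 in front of [x ^+ 2] is
    what makes the Gaussian variance bound sharp. *)
Lemma cosh_ge (x : R) : x ^+ 2 <= expR x + expR (- x) - 2.
Proof.
have key (y : R) : 0 <= y -> y ^+ 2 <= expR y + expR (- y) - 2.
  move=> y0; have h2 := sinh_ge (divr_ge0 y0 (ler0n R 2)).
  have e1 : expR y = expR (y / 2) ^+ 2 by rewrite -expRM_natl; congr expR; field.
  have h3 := expR_gt0 (y / 2).
  have -> : expR y + expR (- y) - 2 = (expR (y / 2) - expR (- (y / 2))) ^+ 2.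
    by rewrite !expRN e1; field; rewrite gt_eqF.
  have yh : y <= expR (y / 2) - expR (- (y / 2)) by apply: le_trans h2; lra.
  by rewrite ler_pXn2r ?nnegrE// (le_trans y0).
have [x0|x0] := leP 0 x; first exact: key.
have := key (- x); rewrite oppr_ge0 opprK sqrrN (addrC (expR (- x))).
by apply; rewrite ltW.
Qed.

Lemma expR_le_invB (u : R) : u < 1 -> expR u <= (1 - u)^-1.
Proof.
move=> u1; have := expR_ge1Dx (- u); rewrite expRN => h.
by rewrite -[expR u]invrK lef_pV2// posrE ?invr_gt0 ?expR_gt0// subr_gt0.
Qed.

End calculus.

Section real_integrable.
Context d (T : measurableType d) (R : realType).
Variable mu : {measure set T -> \bar R}.
Local Notation integ f := (mu.-integrable [set: T] (EFin \o f)).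

Lemma integrableRD (f g : T -> R) :
  integ f -> integ g -> integ (fun x => f x + g x).
Proof.
by move=> hf hg; have := integrableD measurableT hf hg; exact: eq_integrable.
Qed.

Lemma integrableRB (f g : T -> R) :
  integ f -> integ g -> integ (fun x => f x - g x).
Proof.
by move=> hf hg; have := integrableB measurableT hf hg; exact: eq_integrable.
Qed.

Lemma integrableRZ (c : R) (f : T -> R) : integ f -> integ (fun x => c * f x).
Proof.
by move=> hf; have := integrableZl measurableT c hf; exact: eq_integrable.
Qed.

Lemma integrableR_sum (I : Type) (r : seq I) (f : I -> T -> R) :
  (forall i, integ (f i)) -> integ (fun x => \sum_(i <- r) f i x).
Proof.
move=> hf; elim: r => [|i r ih].
  by under [X in _.-integrable _ X]eq_fun do rewrite /= big_nil; exact: integrable0.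
under [X in _.-integrable _ X]eq_fun do rewrite /= big_cons.
exact: integrableRD.
Qed.

Lemma Rintegral_sum (I : Type) (r : seq I) (f : I -> T -> R) :
  (forall i, integ (f i)) ->
  \int[mu]_x (\sum_(i <- r) f i x) = \sum_(i <- r) \int[mu]_x f i x.
Proof.
move=> hf; elim: r => [|i r ih].
  by rewrite big_nil; under eq_Rintegral do rewrite big_nil; rewrite Rintegral_cst// mul0r.
under eq_Rintegral do rewrite big_cons.
by rewrite big_cons RintegralD ?ih//; exact: integrableR_sum.
Qed.

End real_integrable.

(** * Moments of a centered Gaussian *)

Section gaussian_moments.
Context {R : realType} (s : R).
Hypothesis s_gt0 : 0 < s.
Let mu : probability (measurableTypeR R) R := normal_prob 0 s.
Local Notation integ f := (mu.-integrable [set: R] (EFin \o f)).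

Let s_neq0 : s != 0. Proof. by rewrite gt_eqF. Qed.

Lemma measurable_expR_mull (r : R) :
  measurable_fun [set: R] (fun t => expR (r * t)).
Proof. by apply: measurableT_comp => //; exact: measurable_funM. Qed.

Lemma integrable_normal_expR (r : R) : integ (fun t => expR (r * t)).
Proof.
apply/integrableP; split; first by apply/measurable_EFinP; exact: measurable_expR_mull.
under eq_integral do rewrite /= ger0_norm ?expR_ge0//.
by rewrite normal_mgf// ltry.
Qed.

Lemma Rintegral_normal_expR (r : R) :
  \int[mu]_t expR (r * t) = expR (s ^+ 2 * r ^+ 2 / 2).
Proof. by rewrite /Rintegral normal_mgf. Qed.

Lemma integrable_normal_dominated (f : R -> R) (r C : R) :
  measurable_fun [set: R] f ->
  (forall t, `|f t| <= C * (expR (r * t) + expR (- (r * t)))) -> integ f.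
Proof.
move=> mf fC.
have iexp : integ (fun t => C * (expR (r * t) + expR (- r * t))).
  have := integrableZl measurableT C
    (integrableD measurableT (integrable_normal_expR r)
                             (integrable_normal_expR (- r))).
  exact: eq_integrable.
apply: le_integrable iexp => //; first exact/measurable_EFinP.
move=> t _; rewrite /= lee_fin (le_trans (fC t))// mulNr ler_norm//.
Qed.

Lemma Rintegral_normalN (f : R -> R) :
  integ f -> \int[mu]_t f (- t) = \int[mu]_t f t.
Proof.
move=> /measurable_int/measurable_EFinP mf; rewrite /Rintegral; congr fine.
have mF : measurable_fun [set: R] (fun t => (f t)%:E) by exact/measurable_EFinP.
rewrite integralE [RHS]integralE; congr (_ - _)%E.
- rewrite -[RHS](@ge0_integral_normal_probN _ s ((fun t => (f t)%:E)^\+)%E)//.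
    by apply: eq_integral => x _; rewrite !funeposE.
  exact: measurable_funepos.
- rewrite -[RHS](@ge0_integral_normal_probN _ s ((fun t => (f t)%:E)^\-)%E)//.
    by apply: eq_integral => x _; rewrite !funenegE.
  exact: measurable_funeneg.
Qed.

Lemma normr_expr_le_expR (n : nat) (x : R) :
  `|x| ^+ n <= n`!%:R * (expR x + expR (- x)).
Proof.
have fge1 : 1 <= n`!%:R :> R by rewrite ler1n fact_gt0.
have pos_bnd (y : R) : 0 <= y -> y ^+ n <= n`!%:R * expR y.
  move=> y0; case: n fge1 => [|n] fge1.
    by rewrite expr0 fact0 mul1r (le_trans _ (expR_ge1Dx y))// lerDl.
  rewrite mulrC -ler_pdivrMr ?(lt_le_trans ltr01)//.
  by apply: le_trans (expR_ge1Dxn n y0); rewrite lerDr.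
have [x0|x0] := leP 0 x.
  apply: (le_trans (pos_bnd _ (normr_ge0 _))); rewrite ger0_norm// ler_pM2l.
    by rewrite lerDl expR_ge0.
  exact: lt_le_trans fge1.
apply: (le_trans (pos_bnd _ (normr_ge0 _))); rewrite ltr0_norm// ler_pM2l.
  by rewrite lerDr expR_ge0.
exact: lt_le_trans fge1.
Qed.

Lemma integrable_normal_exprn (n : nat) : integ (fun t => t ^+ n).
Proof.
apply: (@integrable_normal_dominated _ 1 n`!%:R) => [|t].
  exact: measurable_funX.
by rewrite normrX mul1r normr_expr_le_expR.
Qed.

Lemma integrable_cst_prob (c : R) : integ (fun=> c).
Proof. exact: finite_measure_integrable_cst. Qed.

Lemma Rintegral_cst_prob (c : R) : \int[mu]_t c = c.
Proof.
rewrite Rintegral_cst; last exact: measurableT.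
by rewrite [fine _](congr1 fine (@probability_setT _ _ _ mu)) mulr1.
Qed.

Lemma normal_mean : \int[mu]_t t = 0.
Proof.
have i1 : integ id by have := integrable_normal_exprn 1.
have := Rintegral_normalN i1.
under eq_Rintegral do rewrite -mulN1r.
rewrite RintegralZl// => h; lra.
Qed.

Lemma normal_moment_le (n : nat) :
  \int[mu]_t (t ^+ n.*2) <= 4 * n.*2`!%:R * s ^+ n.*2.
Proof.
have e2 : expR (s ^+ 2 * s^-1 ^+ 2 / 2) <= 2 :> R.
  rewrite -exprMn divff// expr1n.
  have u1 : 1 / 2 < 1 :> R by lra.
  apply: (le_trans (expR_le_invB u1)).
  by rewrite (_ : 1 - 1 / 2 = 2^-1 :> R) ?invrK//; field.
have iexp := integrable_normal_expR.
(* Each exponential with rate 1/s integrates to e^(1/2) <= 2, whence the factor 4; a crude constant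
   is enough for error terms. *)
have bnd t : t ^+ n.*2 <=
    (n.*2`!%:R * s ^+ n.*2) * (expR (s^-1 * t) + expR (- s^-1 * t)).
  rewrite -{1}(mulVKf s_neq0 t) exprMn mulNr -mulrA mulrCA ler_pM2l ?exprn_gt0//.
  apply: le_trans (normr_expr_le_expR n.*2 (s^-1 * t)).
  by rewrite -normrX ler_norm.
have h : \int[mu]_t (t ^+ n.*2) <= \int[mu]_t ((n.*2`!%:R * s ^+ n.*2) *
    (expR (s^-1 * t) + expR (- s^-1 * t))).
  apply: le_Rintegral => //; first exact: integrable_normal_exprn.
  have := integrableZl measurableT (n.*2`!%:R * s ^+ n.*2)
    (integrableD measurableT (iexp s^-1) (iexp (- s^-1))).
  exact: eq_integrable.
apply: (le_trans h).
rewrite RintegralZl//; last first.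
  have := integrableD measurableT (iexp s^-1) (iexp (- s^-1)).
  exact: eq_integrable.
rewrite RintegralD// !Rintegral_normal_expR sqrrN.
rewrite (_ : 4 * _ * _ = (n.*2`!%:R * s ^+ n.*2) * 4); last by ring.
rewrite ler_wpM2l ?mulr_ge0 ?exprn_ge0 ?(ltW s_gt0)//; lra.
Qed.

(** Here the exact constant is needed, because this moment multiplies the leading term of the
    one-coupling variance. It is read off the moment generating function: r^2 t^2 is at most e^(rt)
    + e^(-rt) - 2, and r tends to 0 through the parameter u = s^2 r^2 / 2. *)
Lemma normal_variance_le : \int[mu]_t (t ^+ 2) <= s ^+ 2.
Proof.
set V := \int[mu]_t (t ^+ 2).
have V0 : 0 <= V by apply: Rintegral_ge0 => t _; exact: sqr_ge0.
have i2 := integrable_normal_exprn 2.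
have step (u : R) : 0 < u -> u < 1 -> (1 - u) * V <= s ^+ 2.
  move=> u0 u1; pose r := Num.sqrt (2 * u) / s.
  have r2 : s ^+ 2 * r ^+ 2 / 2 = u.
    by rewrite expr_div_n sqr_sqrtr; [field|rewrite mulr_ge0// ltW].
  have ie : integ (fun t => expR (r * t) + expR (- r * t) - 2).
    apply: integrableRB; last exact: integrable_cst_prob.
    by apply: integrableRD; exact: integrable_normal_expR.
  have : r ^+ 2 * V <= \int[mu]_t (expR (r * t) + expR (- r * t) - 2).
    rewrite -RintegralZl//; apply: le_Rintegral => //.
      exact: integrableRZ.
    by move=> t _; rewrite -exprMn mulNr cosh_ge.
  have iD : integ (fun t => expR (r * t) + expR (- r * t)).
    by apply: integrableRD; exact: integrable_normal_expR.
  rewrite RintegralB//; last exact: integrable_cst_prob.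
  rewrite RintegralD//; [|exact: integrable_normal_expR..].
  rewrite !Rintegral_normal_expR Rintegral_cst_prob sqrrN r2 => h.
  have e1 := expR_le_invB u1.
  have h' : r ^+ 2 * V <= 2 * ((1 - u)^-1 - 1) by lra.
  have u1' : 0 < 1 - u by rewrite subr_gt0.
  have h2 : (1 - u) * (r ^+ 2 * V) <= 2 * u.
    have -> : 2 * u = (1 - u) * (2 * ((1 - u)^-1 - 1)).
      by field; rewrite gt_eqF.
    by rewrite ler_pM2l.
  rewrite -(@ler_pM2l _ u)//.
  have -> : u * ((1 - u) * V) = s ^+ 2 / 2 * ((1 - u) * (r ^+ 2 * V)).
    by rewrite -{1}r2; ring.
  rewrite (_ : u * s ^+ 2 = s ^+ 2 / 2 * (2 * u)); last by field.
  by rewrite ler_pM2l// divr_gt0// exprn_gt0.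
apply/ler_addgt0Pr => e e0.
pose u := e / (2 * (e + V)).
have eV : 0 < e + V by rewrite ltr_wpDr.
have u0 : 0 < u by rewrite divr_gt0// mulr_gt0.
have u1 : u < 1 by rewrite ltr_pdivrMr ?mulr_gt0// mul1r; lra.
have uV : u * V <= e.
  rewrite mulrAC ler_pdivrMr ?mulr_gt0// ler_pM2l//; lra.
have := step _ u0 u1; lra.
Qed.

End gaussian_moments.

(** * Weighted log-sum-exp functions *)

Lemma sqrn {R : realType} (x : R) : `|x| ^+ 2 = x ^+ 2.
Proof. exact: real_normK (num_real x). Qed.

Section log_sum_exp.
Context {R : realType} {I : finType} (w : I -> R) (i0 : I).
Hypothesis w_gt0 : forall i, 0 < w i.
Implicit Types (b k : I -> R) (t : R).

Lemma wsum_gt0 (f : I -> R) : (forall i, 0 < f i) -> 0 < \sum_i w i * f i.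
Proof.
move=> f0; rewrite (bigD1 i0)//= ltr_wpDr//.
  by apply: sumr_ge0 => i _; rewrite mulr_ge0// ltW.
by rewrite mulr_gt0.
Qed.

Lemma wsum_expR_gt0 b : 0 < \sum_i w i * expR (b i).
Proof. by apply: wsum_gt0 => i; exact: expR_gt0. Qed.

Lemma wtot_gt0 : 0 < \sum_i w i.
Proof.
by rewrite (eq_bigr (fun i => w i * 1)) ?wsum_gt0// => i _; rewrite mulr1.
Qed.

(** Jensen's inequality for unnormalized weights: with m the weighted mean of b, each e^(b i) is at
    least e^m (1 + b i - m), and the linear terms sum to zero. *)
Lemma ln_sum_expR_ge b :
  ln (\sum_i w i) + (\sum_i w i * b i) / (\sum_i w i)
    <= ln (\sum_i w i * expR (b i)).
Proof.
have W0 := wtot_gt0; set W := \sum_i w i in W0 *.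
set m := (X in _ + X <= _).
rewrite -[leLHS]expRK ler_ln ?posrE ?expR_gt0 ?wsum_expR_gt0//.
rewrite expRD lnK ?posrE//.
have -> : W * expR m = \sum_i w i * (expR m * (1 + (b i - m))).
  rewrite (eq_bigr (fun i => expR m * (w i * (1 - m) + w i * b i))); last first.
    by move=> i _; ring.
  rewrite -mulr_sumr big_split/= -mulr_suml -/W mulrC.
  by congr (_ * _); rewrite -[X in _ + X](divfK (lt0r_neq0 W0)) -/m; ring.
apply: ler_sum => i _; rewrite ler_pM2l//.
have -> : expR (b i) = expR m * expR (b i - m) by rewrite -expRD subrKC.
by rewrite ler_pM2l ?expR_gt0// expR_ge1Dx.
Qed.

(** The log partition function in a single coupling [t], all others being absorbed in [w]. The slope
    [k i] will be the spin product along the edge, or the sum of two such products for a pair of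
    replicas. *)
Definition lse k t := ln (\sum_i w i * expR (k i * t)).

Definition gmean k t :=
  (\sum_i w i * expR (k i * t) * k i) / (\sum_i w i * expR (k i * t)).

Lemma lse0 k : lse k 0 = ln (\sum_i w i).
Proof. by congr ln; apply: eq_bigr => i _; rewrite mulr0 expR0 mulr1. Qed.

Lemma gmean0 k : gmean k 0 = (\sum_i w i * k i) / (\sum_i w i).
Proof.
by congr (_ / _); apply: eq_bigr => i _; rewrite mulr0 expR0 mulr1.
Qed.

Lemma measurable_lse k : measurable_fun [set: R] (lse k).
Proof.
apply: measurableT_comp; first exact: measurable_ln.
apply: measurable_sum => i; apply: measurable_funM => //.
by apply: measurableT_comp => //; exact: measurable_funM.
Qed.

Lemma gmean_norm_le k (K : R) t : (forall i, `|k i| <= K) -> `|gmean k t| <= K.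
Proof.
move=> kK; have W0 := wsum_expR_gt0 (fun i => k i * t).
rewrite /gmean normrM normfV (gtr0_norm W0) ler_pdivrMr// mulr_sumr.
apply: (le_trans (ler_norm_sum _ _ _)); apply: ler_sum => i _.
have wi : 0 < w i * expR (k i * t) by rewrite mulr_gt0 ?expR_gt0.
by rewrite normrM (gtr0_norm wi) [leRHS]mulrC ler_pM2l.
Qed.

End log_sum_exp.

(** Moving the base point only tilts the weights, so what holds at 0 for all weights holds
    everywhere. *)
Lemma gmean_shift {R : realType} {I : finType} (w k : I -> R) (u t : R) :
  gmean w k (u + t) = gmean (fun i => w i * expR (k i * u)) k t.
Proof.
by congr (_ / _); apply: eq_bigr => i _; rewrite mulrDr expRD ?mulrA.
Qed.

Lemma lse_shift {R : realType} {I : finType} (w k : I -> R) (u t : R) :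
  lse w k (u + t) = lse (fun i => w i * expR (k i * u)) k t.
Proof.
by congr ln; apply: eq_bigr => i _; rewrite mulrDr expRD mulrA.
Qed.

Section log_sum_exp_slope.
Context {R : realType} {I : finType} (w : I -> R) (i0 : I).
Hypothesis w_gt0 : forall i, 0 < w i.
Implicit Types (b k : I -> R) (t : R).

(** Jensen's inequality for the weights tilted at [u]: convexity without second derivatives. *)
Lemma lse_tangent k u t : lse w k u + gmean w k u * (t - u) <= lse w k t.
Proof.
rewrite -{2}(subrKC u t) lse_shift -[lse w k u](congr1 (lse w k) (addr0 u)).
rewrite lse_shift lse0 -[gmean w k u](congr1 (gmean w k) (addr0 u)).
rewrite gmean_shift gmean0.
have w'0 i : 0 < w i * expR (k i * u) by rewrite mulr_gt0 ?expR_gt0.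
apply: le_trans (ln_sum_expR_ge i0 w'0 (fun i => k i * (t - u))).
rewrite lerD2l mulrAC [X in X / _]mulr_suml.
by rewrite (eq_bigr _ (fun i _ => esym (mulrA _ (k i) (t - u)))).
Qed.

Lemma lse_lip k (K : R) u t : (forall i, `|k i| <= K) ->
  `|lse w k t - lse w k u| <= K * `|t - u|.
Proof.
move=> kK.
have key a c : lse w k a - lse w k c <= K * `|a - c|.
  have := lse_tangent k a c; rewrite -lerBrDl => /= h.
  have : - (gmean w k a * (c - a)) <= K * `|a - c|.
    rewrite -mulrN opprB (le_trans (ler_norm _))// normrM ler_wpM2r//.
    exact: gmean_norm_le.
  lra.
by rewrite ler_norml key andbT lerNl opprB distrC key.
Qed.

Lemma is_derive_lse k t : is_derive t 1 (lse w k) (gmean w k t).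
Proof.
have S0 := wsum_expR_gt0 i0 w_gt0 (fun i => k i * t).
have dS : is_derive t 1 (fun x => \sum_i w i * expR (k i * x))
    (\sum_i w i * expR (k i * t) * k i).
  elim: (index_enum I) => [|i r ih].
    rewrite big_nil (_ : (fun _ => _) = cst 0); first exact: is_derive_cst.
    by apply/funext => x; rewrite big_nil.
  rewrite big_cons (_ : (fun _ => _) = (fun x => w i * expR (k i * x)) +
      (fun x => \sum_(i <- r) w i * expR (k i * x))); last first.
    by apply/funext => x; rewrite big_cons.
  apply: is_deriveD; apply: is_derive_eq.
  by rewrite /GRing.scale/= mulr1 mulrA.
rewrite [gmean w k t]mulrC.
exact: (is_derive1_comp (is_derive1_ln S0) dS).
Qed.

End log_sum_exp_slope.

(** * Hyperbolic functions *)

Section tanh.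
Context {R : realType}.
Implicit Types t : R.

Definition ch t := (expR t + expR (- t)) / 2.
Definition sh t := (expR t - expR (- t)) / 2.
Definition th t := sh t / ch t.

Lemma ch_gt0 t : 0 < ch t.
Proof. by rewrite divr_gt0// addr_gt0 ?expR_gt0. Qed.

Lemma sqr_ch_sh t : ch t ^+ 2 - sh t ^+ 2 = 1.
Proof.
by rewrite -(expRxMexpNx_1 t) /ch /sh; field.
Qed.

Lemma expR_pm1 (k t : R) : k ^+ 2 = 1 -> expR (k * t) = ch t + k * sh t.
Proof.
move/eqP; rewrite -subr_eq0 subr_sqr_1 mulf_eq0 => /orP[].
  by rewrite subr_eq0 => /eqP->; rewrite !mul1r /ch /sh; field.
by rewrite addr_eq0 => /eqP->; rewrite !mulN1r /ch /sh; field.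
Qed.

Lemma is_derive_ch t : is_derive t 1 ch (sh t).
Proof.
rewrite (_ : ch = (fun x => 2^-1 * (expR x + expR (- x)))); last first.
  by apply/funext => x; rewrite mulrC.
by apply: is_derive_eq; rewrite /GRing.scale/= mulrN1 mulrC.
Qed.

Lemma is_derive_sh t : is_derive t 1 sh (ch t).
Proof.
rewrite (_ : sh = (fun x => 2^-1 * (expR x - expR (- x)))); last first.
  by apply/funext => x; rewrite mulrC.
by apply: is_derive_eq; rewrite /GRing.scale/= mulrN1 opprK mulrC.
Qed.

Lemma sh0 : sh 0 = 0. Proof. by rewrite /sh oppr0 subrr mul0r. Qed.
Lemma ch0 : ch 0 = 1. Proof. by rewrite /ch oppr0 expR0; field. Qed.
Lemma shN t : sh (- t) = - sh t. Proof. by rewrite /sh opprK; field. Qed.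
Lemma chN t : ch (- t) = ch t. Proof. by rewrite /ch opprK addrC. Qed.
Lemma thN t : th (- t) = - th t. Proof. by rewrite /th shN chN mulNr. Qed.

Lemma mulr_sh_ge0 t : 0 <= t * sh t.
Proof.
have key u : 0 <= u -> 0 <= sh u.
  by move=> u0; rewrite divr_ge0// subr_ge0 ler_expR; lra.
have [t0|t0] := leP 0 t; first by rewrite mulr_ge0 ?key.
by rewrite -mulrNN -shN mulr_ge0 ?key// oppr_ge0 ltW.
Qed.

Lemma sh_le t : 0 <= t -> sh t <= t * ch t.
Proof.
move=> t0; have [|c _] := @mean_value0 _ (fun x => x * ch x - sh x)
    (fun x => x * sh x) t.
  move=> x; have dc := is_derive_ch x; have ds := is_derive_sh x.
  by apply: is_derive_eq; rewrite /GRing.scale/= mulr1; ring.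
rewrite mul0r sh0 !subr0 => h; rewrite -subr_ge0 h mulr_ge0//.
exact: mulr_sh_ge0.
Qed.

Lemma th_norm_le t : `|th t| <= `|t|.
Proof.
have key u : 0 <= u -> `|th u| <= u.
  move=> u0; rewrite ger0_norm.
    by rewrite ler_pdivrMr ?ch_gt0// sh_le.
  rewrite divr_ge0 ?(ltW (ch_gt0 _))//.
  by rewrite divr_ge0// subr_ge0 ler_expR; lra.
have [t0|t0] := leP 0 t; first by rewrite (ger0_norm t0) key.
by rewrite -normrN -thN (ltr0_norm t0) key// oppr_ge0 ltW.
Qed.

Lemma th_lt1 t : th t ^+ 2 < 1.
Proof.
rewrite expr_div_n ltr_pdivrMr ?exprn_gt0 ?ch_gt0// mul1r.
by rewrite -subr_gt0 sqr_ch_sh.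
Qed.

End tanh.

(** * Log-sum-exp functions whose slopes are signs *)

Section log_sum_exp_pm1.
Context {R : realType} {I : finType} (w k : I -> R) (i0 : I).
Hypothesis w_gt0 : forall i, 0 < w i.
Hypothesis k_pm1 : forall i, k i ^+ 2 = 1.
Let m := gmean w k 0.

Lemma pm1_norm i : `|k i| = 1.
Proof. by apply/eqP; rewrite -sqr_norm_eq1 k_pm1. Qed.

Let m_le1 : `|m| <= 1.
Proof. by apply: (gmean_norm_le i0 w_gt0) => i; rewrite pm1_norm. Qed.

Let mth_gt0 t : 0 < 1 + m * th t.
Proof.
have : `|m * th t| < 1.
  rewrite normrM; have : `|th t| < 1 by have := th_lt1 t; rewrite -sqrn expr_lt1.
  by apply: le_lt_trans; rewrite ler_piMl.
by rewrite ltr_norml => /andP[]; lra.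
Qed.

(** For a sign k, e^(k t) is affine in k, so the weights enter only through their mean [m]. The
    formula is the addition law for tanh (t + artanh m). *)
Lemma gmean_pm1 t : gmean w k t = (m + th t) / (1 + m * th t).
Proof.
have W0 := wtot_gt0 i0 w_gt0; have c0 := ch_gt0 t.
have mW : \sum_i w i * k i = m * \sum_i w i.
  by rewrite /m gmean0 divfK// gt_eqF.
have -> : gmean w k t = ((\sum_i w i) * (m * ch t + sh t)) /
                        ((\sum_i w i) * (ch t + m * sh t)).
  congr (_ / _).
    rewrite mulrDr mulrCA mulrA -mW !mulr_suml -big_split/=.
    apply: eq_bigr => i _; rewrite expR_pm1// -(mulr1 (w i * sh t)) -(k_pm1 i); ring.
  rewrite mulrDr mulrA (mulrC _ m) -mW !mulr_suml -big_split/=.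
  by apply: eq_bigr => i _; rewrite expR_pm1//; ring.
have := mth_gt0 t; rewrite /th => h.
have h' : 0 < ch t + m * sh t.
  have -> : ch t + m * sh t = ch t * (1 + m * (sh t / ch t)).
    by field; rewrite gt_eqF.
  by rewrite mulr_gt0.
by field; rewrite !gt_eqF//= mulr_gt0.
Qed.

(** Symmetrizing the Moebius map in T = th t leaves a deviation from 2 m with a factor T^2. Its
    coefficient stays bounded as |m| approaches 1, because 1 - m^2 compensates the denominator 1 -
    m^2 T^2. *)
Lemma gmean_pm1_even t : `|gmean w k t + gmean w k (- t) - 2 * m| <= 2 * t ^+ 2.
Proof.
have h1 := mth_gt0 t; have := mth_gt0 (- t); rewrite !gmean_pm1 thN mulrN => h2.
have T1 := th_lt1 t.
have Tt : th t ^+ 2 <= t ^+ 2.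
  by rewrite -[leLHS]sqrn -[leRHS]sqrn ler_pXn2r ?nnegrE// th_norm_le.
have m2 : m ^+ 2 <= 1 by rewrite -sqrn expr_le1.
set T := th t in h1 h2 T1 Tt *.
have d0 : 0 < 1 - m ^+ 2 * T ^+ 2.
  by rewrite (_ : _ - _ = (1 + m * T) * (1 - m * T)) ?mulr_gt0//; ring.
have -> : (m + T) / (1 + m * T) + (m - T) / (1 - m * T) - 2 * m =
    - (2 * m * (T ^+ 2 * (1 - m ^+ 2) / (1 - m ^+ 2 * T ^+ 2))).
  by field; rewrite exprMn !gt_eqF.
have q0 : 0 <= T ^+ 2 * (1 - m ^+ 2) / (1 - m ^+ 2 * T ^+ 2).
  by rewrite divr_ge0 ?(ltW d0)// mulr_ge0 ?sqr_ge0// subr_ge0.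
have q1 : T ^+ 2 * (1 - m ^+ 2) / (1 - m ^+ 2 * T ^+ 2) <= T ^+ 2.
  rewrite ler_pdivrMr// ler_wpM2l ?sqr_ge0//; have := sqr_ge0 m; nra.
rewrite normrN (normrM (2 * m)) (ger0_norm q0) normrM (ger0_norm (ler0n R 2)) -mulrA ler_pM2l//.
by apply: le_trans Tt; apply: le_trans q1; rewrite ler_piMl.
Qed.

Lemma gmean_pm1_odd t : `|gmean w k t - gmean w k (- t)| <= 2 * `|t|.
Proof.
have h1 := mth_gt0 t; have := mth_gt0 (- t); rewrite !gmean_pm1 thN mulrN => h2.
have T1 := th_lt1 t; have Tt := th_norm_le t.
have m2 : m ^+ 2 <= 1 by rewrite -sqrn expr_le1.
set T := th t in h1 h2 T1 Tt *.
have d0 : 0 < 1 - m ^+ 2 * T ^+ 2.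
  by rewrite (_ : _ - _ = (1 + m * T) * (1 - m * T)) ?mulr_gt0//; ring.
have -> : (m + T) / (1 + m * T) - (m - T) / (1 - m * T) =
    2 * T * ((1 - m ^+ 2) / (1 - m ^+ 2 * T ^+ 2)).
  by field; rewrite exprMn !gt_eqF.
have q0 : 0 <= (1 - m ^+ 2) / (1 - m ^+ 2 * T ^+ 2).
  by rewrite divr_ge0 ?(ltW d0)// subr_ge0.
have q1 : (1 - m ^+ 2) / (1 - m ^+ 2 * T ^+ 2) <= 1.
  rewrite ler_pdivrMr// mul1r; have := sqr_ge0 m; nra.
rewrite (normrM (2 * T)) (ger0_norm q0) normrM (ger0_norm (ler0n R 2)) -mulrA ler_pM2l//.
by apply: le_trans Tt; rewrite ler_piMr.
Qed.

(** The derivative of the expression is the symmetrized slope bounded in [gmean_pm1_even]; the mean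
    value theorem gains one power of t. *)
Lemma lse_pm1_odd t : `|lse w k t - lse w k (- t) - 2 * m * t| <= 2 * `|t| ^+ 3.
Proof.
have [|c ct] := @mean_value0 _ (fun x => lse w k x - lse w k (- x) - 2 * m * x)
    (fun x => gmean w k x + gmean w k (- x) - 2 * m) t.
  move=> x; have d1 := is_derive_lse i0 w_gt0 k x.
  have d2 := is_derive_lse i0 w_gt0 k (- x).
  have d3 : is_derive x 1 (lse w k \o -%R) (gmean w k (- x) * -1).
    exact: is_derive1_comp.
  by apply: is_derive_eq; rewrite /GRing.scale/= mulrN1 opprK mulr1.
rewrite oppr0 mulr0 !subr0 subrr subr0 => ->; rewrite normrM.
apply: (@le_trans _ _ (2 * c ^+ 2 * `|t|)).
  by rewrite ler_wpM2r// gmean_pm1_even.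
rewrite (exprSr _ 2) mulrA ler_wpM2r// ler_pM2l// -(sqrn c).
by rewrite ler_pXn2r ?nnegrE.
Qed.

(** Tangents at 0 make the second difference nonnegative; tangents at t and -t bound it by t times
    the difference of the slopes there. *)
Lemma lse_pm1_even t :
  `|lse w k t + lse w k (- t) - 2 * lse w k 0| <= 2 * t ^+ 2.
Proof.
have a1 := lse_tangent i0 w_gt0 k 0 t.
have a2 := lse_tangent i0 w_gt0 k 0 (- t).
have b1 := lse_tangent i0 w_gt0 k t 0.
have b2 := lse_tangent i0 w_gt0 k (- t) 0.
have c1 : (gmean w k t - gmean w k (- t)) * t <= 2 * t ^+ 2.
  apply: (le_trans (ler_norm _)); rewrite normrM.
  rewrite -(sqrn t) expr2 mulrA ler_wpM2r//; exact: gmean_pm1_odd.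
rewrite ger0_norm; lra.
Qed.

End log_sum_exp_pm1.

(** * Gaussian integrals of log-sum-exp functions *)

Section gaussian_estimates.
Context {R : realType} (s : R).
Hypothesis s_gt0 : 0 < s.
Let mu : probability (measurableTypeR R) R := normal_prob 0 s.
Local Notation integ f := (mu.-integrable [set: R] (EFin \o f)).

Lemma integrable_normal_poly (n : nat) (A B : R) (f : R -> R) :
  measurable_fun [set: R] f -> 0 <= A -> 0 <= B ->
  (forall t, `|f t| <= A + B * `|t| ^+ n) -> integ f.
Proof.
move=> mf A0 B0 hf.
apply: (@integrable_normal_dominated _ s s_gt0 f 1 (A + B * n`!%:R)) => // t.
rewrite mul1r; apply: (le_trans (hf t)); rewrite mulrDl lerD//.
  have := normr_expr_le_expR 0 t; rewrite expr0 fact0 mul1r => h.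
  by rewrite -[leLHS]mulr1 ler_wpM2l.
by rewrite -mulrA ler_wpM2l// normr_expr_le_expR.
Qed.

Lemma integrable_normal_lse (I : finType) (i0 : I) (w k : I -> R) (K b : R) :
  (forall i, 0 < w i) -> (forall i, `|k i| <= K) ->
  integ (fun t => lse w k (t + b)).
Proof.
move=> w0 kK; have K0 : 0 <= K by exact: le_trans (kK i0).
apply: (@integrable_normal_poly 1 `|lse w k b| K) => // [|t].
  by apply: measurableT_comp; [exact: measurable_lse|exact: measurable_funD].
rewrite expr1; have := lse_lip i0 w0 b (t + b) kK; rewrite addrK => h.
rewrite -[X in `|X|](subrK (lse w k b)) addrC.
by rewrite (le_trans (ler_normD _ _))// lerD2l.
Qed.

Let Rexp (r c : R) : \int[mu]_t expR (r * t + c) = expR (s ^+ 2 * r ^+ 2 / 2 + c).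
Proof.
under eq_Rintegral do rewrite expRD.
rewrite RintegralZr ?(Rintegral_normal_expR s_gt0) -?expRD//.
exact: integrable_normal_expR.
Qed.

Let iexp (r c : R) : integ (fun t => expR (r * t + c)).
Proof.
apply: (eq_integrable _ _ _ _ (integrableRZ (expR c) (integrable_normal_expR s_gt0 r))) => //.
by move=> t _; rewrite /= addrC expRD.
Qed.

(* Jensen's inequality after a Girsanov change of density. *)
Lemma gaussian_lse_le (I : finType) (i0 : I) (w k : I -> R) (K b : R) :
  (forall i, 0 < w i) -> (forall i, `|k i| <= K) ->
  \int[mu]_t lse w k (t + b) <=
    b ^+ 2 / (2 * s ^+ 2) + ln (\sum_i w i * expR (s ^+ 2 * k i ^+ 2 / 2)).
Proof.
move=> w0 kK; have sn0 : s != 0 by rewrite gt_eqF.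
set A := \sum_i _; have A0 : 0 < A by exact: wsum_expR_gt0.
(* [Y t] is the partition function at [t + b] times the density of N(-b, s^2) with respect to N(0,
   s^2); hence its mean is [A]. *)
pose Y t := \sum_i w i * expR ((k i - b / s ^+ 2) * t + (k i * b - b ^+ 2 / (2 * s ^+ 2))).
have Y0 t : 0 < Y t by exact: wsum_expR_gt0.
have YE t : Y t = (\sum_i w i * expR (k i * (t + b))) *
    expR (- (b / s ^+ 2 * t + b ^+ 2 / (2 * s ^+ 2))).
  rewrite mulr_suml; apply: eq_bigr => i _; rewrite -mulrA -expRD.
  by congr (_ * expR _); ring.
have iY : integ Y by apply: integrableR_sum => i; apply: integrableRZ; exact: iexp.
have intY : \int[mu]_t Y t = A.
  rewrite Rintegral_sum; last by move=> i; apply: integrableRZ; exact: iexp.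
  apply: eq_bigr => i _; rewrite RintegralZl// ?Rexp//.
  by congr (_ * expR _); field.
(* Jensen in pointwise form, ln Y <= ln A + Y / A - 1; the last two terms cancel in the mean. *)
have bnd t : lse w k (t + b) <=
    (ln A + b ^+ 2 / (2 * s ^+ 2) - 1) + (b / s ^+ 2 * t + A^-1 * Y t).
  have Z0 := wsum_expR_gt0 i0 w0 (fun i => k i * (t + b)).
  have -> : lse w k (t + b) = ln (Y t) + (b / s ^+ 2 * t + b ^+ 2 / (2 * s ^+ 2)).
    rewrite YE lnM ?posrE ?expR_gt0// expRK /lse; ring.
  have : ln (Y t) <= ln A + (A^-1 * Y t - 1).
    have -> : Y t = A * (A^-1 * Y t) by rewrite mulVKf// gt_eqF.
    have AY : 0 < A^-1 * Y t by rewrite mulr_gt0// invr_gt0.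
    rewrite lnM ?posrE// mulKf ?gt_eqF// lerD2l.
    by rewrite -{1}(subrKC 1 (A^-1 * Y t)) le_ln1Dx// ltrBDr addNr.
  lra.
have it : integ (fun t => t) by have := integrable_normal_exprn s_gt0 1.
apply: (@le_trans _ _ (\int[mu]_t ((ln A + b ^+ 2 / (2 * s ^+ 2) - 1) +
    (b / s ^+ 2 * t + A^-1 * Y t)))).
  apply: le_Rintegral => //; first exact: integrable_normal_lse kK.
  apply: integrableRD; first exact: integrable_cst_prob.
  by apply: integrableRD; [exact: (integrableRZ _ it)|exact: (integrableRZ _ iY)].
have i1 : integ (fun t => b / s ^+ 2 * t + A^-1 * Y t).
  by apply: integrableRD; [exact: (integrableRZ _ it)|exact: (integrableRZ _ iY)].
have i2 := integrableRZ (b / s ^+ 2) it; have i3 := integrableRZ A^-1 iY.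
have ic := @integrable_cst_prob _ s.
rewrite (RintegralD measurableT (ic _) i1) (RintegralD measurableT i2 i3).
rewrite !RintegralZl// Rintegral_cst_prob normal_mean// intY mulVf ?gt_eqF//.
by rewrite mulr0; lra.
Qed.

Lemma expR_le_quad (u : R) : `|u| <= 1 / 2 -> expR u <= 1 + u + 2 * u ^+ 2.
Proof.
rewrite ler_norml => /andP[u1 u2].
have u3 : u < 1 by lra.
apply: (le_trans (expR_le_invB u3)).
rewrite -[leLHS]mul1r ler_pdivrMr ?subr_gt0//.
have u4 : 0 <= 1 - 2 * u by lra.
have := mulr_ge0 (sqr_ge0 u) u4; lra.
Qed.

(** Up to O(s^4) this matches the upper bound [gaussian_lse_le], and the drift s^2 a with a the mean
    slope is the one that achieves it: centering the slopes at a removes the order s^2 from the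
    relative variance of the partition function, so a second-order expansion of ln loses only
    O(s^4). *)
Lemma gaussian_lse_ge (I : finType) (i0 : I) (w k : I -> R) :
  s <= 1 -> (forall i, 0 < w i) -> (forall i, k i ^+ 2 = 1) ->
  lse w k 0 + s ^+ 2 / 2 + s ^+ 2 * gmean w k 0 ^+ 2 / 2 - 64 * s ^+ 4 <=
  \int[mu]_t lse w k (t + s ^+ 2 * gmean w k 0).
Proof.
move=> s1 w0 k1; set a := gmean w k 0.
have kn i : `|k i| <= 1 by rewrite pm1_norm.
have a1 : `|a| <= 1 by exact: gmean_norm_le.
have W0 := wtot_gt0 i0 w0; set W := \sum_i w i in W0.
have s20 : 0 < s ^+ 2 by rewrite exprn_gt0.
have ilse := integrable_normal_lse i0 (s ^+ 2 * a) w0 kn.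
have it : integ (fun t => t) by have := integrable_normal_exprn s_gt0 1.
(* Above 1/8 the error 64 s^4 exceeds 8 s^2 and the tangent at 0 suffices. Below it, the exponents
   [u i j] stay within [-1/2, 1/2], as [expR_le_quad] requires. *)
have [s8|s8] := ltP (1 / 8) (s ^+ 2).
  have h1 : lse w k 0 + s ^+ 2 * a ^+ 2 <= \int[mu]_t lse w k (t + s ^+ 2 * a).
    have -> : lse w k 0 + s ^+ 2 * a ^+ 2 =
        \int[mu]_t ((lse w k 0 + s ^+ 2 * a ^+ 2) + a * t).
      rewrite (RintegralD measurableT (integrable_cst_prob _ _) (integrableRZ a it)).
      by rewrite RintegralZl// Rintegral_cst_prob normal_mean// mulr0 addr0.
    apply: le_Rintegral => //.
      by apply: integrableRD; [exact: integrable_cst_prob|exact: (integrableRZ _ it)].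
    move=> t _; apply: le_trans (lse_tangent i0 w0 k 0 _); rewrite -/a subr0.
    lra.
  have h2 : 0 <= s ^+ 2 * a ^+ 2 by rewrite mulr_ge0 ?sqr_ge0.
  have h3 : s ^+ 4 = s ^+ 2 * s ^+ 2 by rewrite -exprD.
  nra.
pose p i := w i / W.
have p0 i : 0 < p i by rewrite divr_gt0.
have sp : \sum_i p i = 1 by rewrite -mulr_suml divff// gt_eqF.
have spk : \sum_i p i * k i = a.
  by rewrite /a gmean0 -/W mulr_suml; apply: eq_bigr => i _; rewrite mulrAC.
(* The normalized partition function at the drifted point, with the factor e^(a t + s^2 a^2 / 2)
   divided out. Its mean is [M], and Jensen's inequality bounds it below by 1. *)
pose X t := \sum_i p i * expR ((k i - a) * t + (k i * (s ^+ 2 * a) - s ^+ 2 * a ^+ 2 / 2)).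
pose M := expR (s ^+ 2 / 2).
have M0 : 0 < M by exact: expR_gt0.
have M2 : M <= 2.
  have h : s ^+ 2 / 2 < 1 by lra.
  apply: (le_trans (expR_le_invB h)); rewrite -[2]invrK lef_pV2 ?posrE ?invr_gt0//; lra.
have X1 t : 1 <= X t.
  have X0 : 0 < X t by exact: wsum_expR_gt0.
  have := ln_sum_expR_ge i0 p0
    (fun i => (k i - a) * t + (k i * (s ^+ 2 * a) - s ^+ 2 * a ^+ 2 / 2)).
  rewrite sp ln1 add0r divr1 -/(X t) (_ : \sum_i _ = s ^+ 2 * a ^+ 2 / 2); last first.
    rewrite (eq_bigr (fun i => (t + s ^+ 2 * a) * (p i * k i) -
       (a * t + s ^+ 2 * a ^+ 2 / 2) * p i)); last by move=> i _; ring.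
    by rewrite big_split/= sumrN -!mulr_sumr sp spk; field.
  move=> h; rewrite -(@ler_ln _ 1) ?posrE// ln1; apply: le_trans h.
  by rewrite mulr_ge0// mulr_ge0 ?sqr_ge0 ?ltW.
have iX : integ X by apply: integrableR_sum => i; apply: integrableRZ; exact: iexp.
have intX : \int[mu]_t X t = M.
  rewrite Rintegral_sum; last by move=> i; apply: integrableRZ; exact: iexp.
  transitivity (\sum_i p i * M); last by rewrite -mulr_suml sp mul1r.
  apply: eq_bigr => i _.
  rewrite RintegralZl// ?Rexp//.
  congr (_ * expR _); transitivity (s ^+ 2 * k i ^+ 2 / 2); first by field.
  by rewrite k1 mulr1.
pose X2 t := \sum_i \sum_j p i * p j * expR ((k i + k j - 2 * a) * t +
   ((k i + k j) * (s ^+ 2 * a) - s ^+ 2 * a ^+ 2)).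
have X2E t : X t ^+ 2 = X2 t.
  rewrite expr2 mulr_suml; apply: eq_bigr => i _; rewrite mulr_sumr.
  apply: eq_bigr => j _; rewrite mulrACA -expRD; congr (_ * expR _); by field.
have iX2 : integ X2.
  by do 2 (apply: integrableR_sum => ?); apply: integrableRZ; exact: iexp.
pose u i j := s ^+ 2 * ((k i - a) * (k j - a)).
have intX2 : \int[mu]_t X2 t = M ^+ 2 * (\sum_i \sum_j p i * p j * expR (u i j)).
  rewrite Rintegral_sum; last first.
    by move=> i; apply: integrableR_sum => j; apply: integrableRZ; exact: iexp.
  rewrite mulr_sumr; apply: eq_bigr => i _.
  rewrite Rintegral_sum; last by move=> j; apply: integrableRZ; exact: iexp.
  rewrite mulr_sumr; apply: eq_bigr => j _.
  rewrite RintegralZl// ?Rexp//.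
  rewrite [RHS]mulrCA; congr (_ * _); rewrite /M -expRM_natl -expRD; congr expR.
  have -> : 2%:R * (s ^+ 2 / 2) = s ^+ 2 / 2 * (k i ^+ 2 + k j ^+ 2) by rewrite !k1; field.
  by rewrite /u; field.
(* The linear term vanishes because the slopes are centered; 32 is 2 * 4^2, from |u i j| <= 4
   s^2. *)
have su : \sum_i \sum_j p i * p j * expR (u i j) <= 1 + 32 * s ^+ 4.
  have ub i j : `|(k i - a) * (k j - a)| <= 4.
    have e l : `|k l - a| <= 2.
      rewrite (le_trans (ler_normB _ _))//; have := kn l; lra.
    by rewrite normrM (_ : 4 = 2 * 2) ?ler_pM//; ring.
  apply: (@le_trans _ _ (\sum_i \sum_j (p i * p j * (1 + 32 * s ^+ 4) +
      s ^+ 2 * (p i * (k i - a) * (p j * (k j - a)))))).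
    apply: ler_sum => i _; apply: ler_sum => j _.
    have pp : 0 < p i * p j by rewrite mulr_gt0.
    rewrite (_ : _ + _ = p i * p j * (1 + u i j + 32 * s ^+ 4)); last by rewrite /u; ring.
    rewrite ler_pM2l//; apply: (le_trans (expR_le_quad _)).
      rewrite normrM (ger0_norm (ltW s20)).
      apply: (@le_trans _ _ (1 / 8 * 4)); last lra.
      by rewrite ler_pM// ltW.
    rewrite lerD2l (_ : 32 * s ^+ 4 = 2 * (s ^+ 2 * 4) ^+ 2); last by ring.
    have s24 : 0 <= s ^+ 2 * 4 by rewrite mulr_ge0// ltW.
    rewrite ler_pM2l// -(sqrn (u i j)) ler_pXn2r ?nnegrE//.
    by rewrite /u normrM (ger0_norm (ltW s20)) ler_pM2l.
  rewrite (eq_bigr (fun i => p i * (1 + 32 * s ^+ 4) +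
      p i * (k i - a) * (s ^+ 2 * \sum_j p j * (k j - a)))); last first.
    move=> i _; rewrite big_split/= -mulr_suml -mulr_sumr -mulr_sumr sp.
    by rewrite mulr1 -mulr_sumr; ring.
  rewrite big_split/= -mulr_suml sp mul1r.
  have -> : \sum_j p j * (k j - a) = 0.
    rewrite (eq_bigr (fun j => p j * k j - p j * a)); last by move=> j _; ring.
    by rewrite big_split/= sumrN -mulr_suml sp spk mul1r subrr.
  by rewrite mulr0 -mulr_suml mulr0 addr0.
(* For x = X / M >= 1 / M one has ln x >= 1 - 1/x >= (x - 1) - M (x - 1)^2, whose mean involves only
   the first two moments of X. *)
have bnd t : (lse w k 0 + s ^+ 2 * a ^+ 2 / 2 + s ^+ 2 / 2 - 1 - M) +
    (a * t + ((1 + 2 * M) / M * X t - M^-1 * X2 t)) <= lse w k (t + s ^+ 2 * a).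
  have X0 : 0 < X t by apply: lt_le_trans (X1 t).
  have -> : lse w k (t + s ^+ 2 * a) =
      ln (X t) + (lse w k 0 + a * t + s ^+ 2 * a ^+ 2 / 2).
    have -> : X t = W^-1 * (\sum_i w i * expR (k i * (t + s ^+ 2 * a))) *
        expR (- (a * t + s ^+ 2 * a ^+ 2 / 2)).
      rewrite mulr_sumr mulr_suml; apply: eq_bigr => i _.
      rewrite /p (mulrC (w i)) -[LHS]mulrA -[RHS]mulrA; congr (_ * _).
      by rewrite -[RHS]mulrA -expRD; congr (_ * expR _); ring.
    have Z0 := wsum_expR_gt0 i0 w0 (fun i => k i * (t + s ^+ 2 * a)).
    rewrite !lnM ?posrE ?expR_gt0 ?mulr_gt0 ?invr_gt0// expRK lse0 lnV ?posrE//.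
    by rewrite /lse -/W; ring.
  have -> : X t = M * (X t / M) by field; rewrite gt_eqF.
  rewrite -X2E; set x := X t / M.
  have x0 : 0 < x by rewrite divr_gt0.
  have xM : x^-1 <= M by rewrite invf_div ler_pdivrMr// ler_peMr// ltW.
  have lnx : 1 - x^-1 <= ln x.
    have := @le_ln1Dx R (x^-1 - 1); rewrite subrKC lnV ?posrE// => h.
    have : - ln x <= x^-1 - 1 by apply: h; rewrite ltrBDr addNr invr_gt0.
    lra.
  rewrite lnM ?posrE// expRK.
  have -> : (1 + 2 * M) / M * (M * x) - M^-1 * (X t) ^+ 2 =
     (1 + 2 * M) * x - M * x ^+ 2.
    by rewrite /x; field; rewrite gt_eqF.
  have : 1 - x^-1 >= (x - 1) - M * (x - 1) ^+ 2.
    have -> : 1 - x^-1 = (x - 1) - x^-1 * (x - 1) ^+ 2 by field; rewrite gt_eqF.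
    by rewrite lerD2l lerN2 ler_wpM2r ?sqr_ge0.
  lra.
have i1 : integ (fun t => (1 + 2 * M) / M * X t - M^-1 * X2 t).
  by apply: integrableRB; [exact: (integrableRZ _ iX)|exact: (integrableRZ _ iX2)].
have i2 : integ (fun t => a * t + ((1 + 2 * M) / M * X t - M^-1 * X2 t)).
  by apply: integrableRD => //; exact: (integrableRZ _ it).
apply: (@le_trans _ _ (\int[mu]_t ((lse w k 0 + s ^+ 2 * a ^+ 2 / 2 + s ^+ 2 / 2 - 1 - M) +
    (a * t + ((1 + 2 * M) / M * X t - M^-1 * X2 t))))); last first.
  by apply: le_Rintegral => //; apply: integrableRD => //; exact: integrable_cst_prob.
rewrite (RintegralD measurableT (integrable_cst_prob _ _) i2).
rewrite (RintegralD measurableT (integrableRZ a it) i1).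
rewrite (RintegralB measurableT (integrableRZ _ iX) (integrableRZ _ iX2)).
rewrite !RintegralZl// Rintegral_cst_prob normal_mean// intX intX2 mulr0 divfK ?gt_eqF//.
rewrite (_ : M^-1 * _ = M * (\sum_i \sum_j p i * p j * expR (u i j))); last first.
  by field; rewrite gt_eqF.
have s40 : 0 < s ^+ 4 by rewrite exprn_gt0.
have : M * (\sum_i \sum_j p i * p j * expR (u i j)) <= M * (1 + 32 * s ^+ 4).
  by rewrite ler_pM2l.
nra.
Qed.

End gaussian_estimates.

Section gaussian_variance.
Context {R : realType} (s : R).
Hypothesis s_gt0 : 0 < s.
Let mu : probability (measurableTypeR R) R := normal_prob 0 s.
Local Notation integ f := (mu.-integrable [set: R] (EFin \o f)).

(* The odd part of [g] is linear up to a cubic error and its even part is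
   quadratic; the slope at 0 and the mean slope differ by O(s^2). *)
Lemma gaussian_variance_le (g p : R -> R) (p0 : R) :
  s <= 1 -> measurable_fun [set: R] g -> measurable_fun [set: R] p ->
  (forall t, `|g t - g 0| <= `|t|) -> (forall t, `|p t| <= 1) -> `|p0| <= 1 ->
  (forall t, `|g t - g (- t) - 2 * p0 * t| <= 2 * `|t| ^+ 3) ->
  (forall t, `|g t + g (- t) - 2 * g 0| <= 2 * t ^+ 2) ->
  (forall t, `|p t + p (- t) - 2 * p0| <= 2 * t ^+ 2) ->
  \int[mu]_t (g t ^+ 2) - (\int[mu]_t g t) ^+ 2 <=
    s ^+ 2 * (\int[mu]_t p t) ^+ 2 + 3200 * s ^+ 4.
Proof.
move=> s1 mg mp lipg p1 p01 odd_g even_g even_p.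
have ig : integ g.
  apply: (@integrable_normal_poly _ s s_gt0 1 `|g 0| 1) => // t.
  rewrite expr1 mul1r -[X in `|X|](subrK (g 0)) addrC.
  by rewrite (le_trans (ler_normD _ _))// lerD2l.
pose h t := g t - g 0.
have mh : measurable_fun [set: R] h by exact: measurable_funB.
have ih : integ h by apply: integrableRB => //; exact: integrable_cst_prob.
have ih2 : integ (fun t => h t ^+ 2).
  apply: (@integrable_normal_poly _ s s_gt0 2 0 1) => // [|t].
    exact: measurable_funX.
  by rewrite add0r mul1r normrX ler_pXn2r ?nnegrE//; exact: lipg.
have ip : integ p.
  apply: (@integrable_normal_poly _ s s_gt0 0 1 0) => // t.
  by rewrite mul0r addr0.
have i2 := integrable_normal_exprn s_gt0 2.
have i4 := integrable_normal_exprn s_gt0 4.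
have i6 := integrable_normal_exprn s_gt0 6.
have s20 : 0 < s ^+ 2 by rewrite exprn_gt0.
have s21 : s ^+ 2 <= 1 by rewrite expr_le1// ltW.
have E4 : \int[mu]_t (t ^+ 4) <= 96 * s ^+ 4.
  by have := normal_moment_le s_gt0 2; rewrite -natrM.
have E6 : \int[mu]_t (t ^+ 6) <= 2880 * s ^+ 4.
  have := normal_moment_le s_gt0 3; rewrite -natrM => /le_trans; apply.
  have -> : s ^+ 3.*2 = s ^+ 2 * s ^+ 4 by rewrite -exprD.
  by rewrite ler_pM2l// ler_piMl// exprn_ge0// ltW.
have E2 : \int[mu]_t (t ^+ 2) <= s ^+ 2 by exact: normal_variance_le.
have vh : \int[mu]_t (g t ^+ 2) - (\int[mu]_t g t) ^+ 2 <= \int[mu]_t (h t ^+ 2).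
  have -> : \int[mu]_t g t = \int[mu]_t h t + g 0.
    rewrite (RintegralB measurableT ig (integrable_cst_prob _ _)).
    by rewrite Rintegral_cst_prob subrK.
  have -> : \int[mu]_t (g t ^+ 2) =
      \int[mu]_t (h t ^+ 2) + (2 * g 0 * \int[mu]_t h t + g 0 ^+ 2).
    have <- : \int[mu]_t (2 * g 0 * h t + g 0 ^+ 2) =
        2 * g 0 * \int[mu]_t h t + g 0 ^+ 2.
      rewrite (RintegralD measurableT (integrableRZ _ ih) (integrable_cst_prob _ _)).
      by rewrite RintegralZl// Rintegral_cst_prob.
    rewrite -(RintegralD measurableT) //; last first.
      by apply: integrableRD; [exact: (integrableRZ _ ih)|exact: integrable_cst_prob].
    by apply: eq_Rintegral => t _; rewrite /h; ring.
  by have := sqr_ge0 (\int[mu]_t h t); lra.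
have ih2N : integ (fun t => h (- t) ^+ 2).
  apply: (@integrable_normal_poly _ s s_gt0 2 0 1) => // [|t].
    by apply: measurable_funX; apply: measurableT_comp.
  by rewrite add0r mul1r normrX ler_pXn2r ?nnegrE// -(normrN t); exact: lipg.
have hsym : \int[mu]_t (h t ^+ 2) = \int[mu]_t (1 / 2 * (h t ^+ 2 + h (- t) ^+ 2)).
  rewrite RintegralZl//; last exact: (integrableRD ih2 ih2N).
  by rewrite (RintegralD measurableT ih2 ih2N) (Rintegral_normalN s_gt0 ih2); field.
(* Symmetrizing removes the cross term between the odd part [o] and the even part [e]. The
   coefficient 3 bounds 2 |p0| + 1. *)
have bnd t : 1 / 2 * (h t ^+ 2 + h (- t) ^+ 2) <=
    p0 ^+ 2 * t ^+ 2 + (3 * t ^+ 4 + t ^+ 6).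
  pose o := (h t - h (- t)) / 2; pose e := (h t + h (- t)) / 2.
  have -> : 1 / 2 * (h t ^+ 2 + h (- t) ^+ 2) = o ^+ 2 + e ^+ 2 by rewrite /o /e; field.
  have he : e ^+ 2 <= t ^+ 4.
    have : `|e| <= t ^+ 2.
      rewrite /e normrM [X in _ * X]ger0_norm// ler_pdivrMr// mulrC.
      by rewrite (_ : h t + _ = g t + g (- t) - 2 * g 0)//; rewrite /h; ring.
    have -> : t ^+ 4 = (t ^+ 2) ^+ 2 by rewrite -exprM.
    by move=> h1; rewrite -sqrn ler_pXn2r ?nnegrE// sqr_ge0.
  have ho : `|o| <= `|p0| * `|t| + `|t| ^+ 3.
    have -> : o = p0 * t + (g t - g (- t) - 2 * p0 * t) / 2 by rewrite /o /h; field.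
    rewrite (le_trans (ler_normD _ _))// normrM lerD2l normf_div (ger0_norm (ler0n R 2)).
    by rewrite ler_pdivrMr// [leRHS]mulrC.
  have ho2 : o ^+ 2 <= (`|p0| * `|t| + `|t| ^+ 3) ^+ 2.
    by rewrite -sqrn ler_pXn2r ?nnegrE// addr_ge0 ?mulr_ge0.
  apply: (le_trans (lerD ho2 he)).
  have a4 : `|t| ^+ 4 = t ^+ 4 by rewrite (exprM _ 2 2) sqrn -exprM.
  have a6 : `|t| ^+ 6 = t ^+ 6 by rewrite (exprM _ 2 3) sqrn -exprM.
  have -> : (`|p0| * `|t| + `|t| ^+ 3) ^+ 2 =
      `|p0| ^+ 2 * `|t| ^+ 2 + 2 * `|p0| * `|t| ^+ 4 + `|t| ^+ 6 by ring.
  rewrite !sqrn a4 a6; have t4 : 0 <= t ^+ 4 by rewrite -a4 exprn_ge0.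
  nra.
(* 3168 = 3 * 96 + 2880; replacing [p0] by the mean slope adds another 3, still below 3200. *)
have h2le : \int[mu]_t (h t ^+ 2) <= p0 ^+ 2 * s ^+ 2 + 3168 * s ^+ 4.
  rewrite hsym; apply: (@le_trans _ _
    (\int[mu]_t (p0 ^+ 2 * t ^+ 2 + (3 * t ^+ 4 + t ^+ 6)))).
    apply: le_Rintegral => //.
      exact: (integrableRZ _ (integrableRD ih2 ih2N)).
    exact: (integrableRD (integrableRZ _ i2) (integrableRD (integrableRZ _ i4) i6)).
  rewrite (RintegralD measurableT (integrableRZ _ i2) (integrableRD (integrableRZ _ i4) i6)).
  rewrite (RintegralD measurableT (integrableRZ _ i4) i6) !RintegralZl//.
  have := ler_wpM2l (sqr_ge0 p0) E2; lra.
have ipN : integ (fun t => p (- t)).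
  apply: (@integrable_normal_poly _ s s_gt0 0 1 0) => // [|t].
    exact: measurableT_comp.
  by rewrite mul0r addr0.
set Pm := \int[mu]_t p t.
have ipp := integrableRD ip ipN.
have ippB := integrableRB ipp (integrable_cst_prob s (2 * p0)).
have Pp : `|Pm - p0| <= s ^+ 2.
  have -> : Pm - p0 = 1 / 2 * \int[mu]_t (p t + p (- t) - 2 * p0).
    rewrite (RintegralB measurableT ipp (integrable_cst_prob _ _)).
    rewrite (RintegralD measurableT ip ipN) Rintegral_cst_prob (Rintegral_normalN s_gt0 ip).
    by rewrite -/Pm; field.
  have -> : s ^+ 2 = 1 / 2 * (2 * s ^+ 2) by field.
  rewrite normrM ger0_norm// ler_pM2l//.
  apply: (le_trans (le_normr_Rintegral measurableT ippB)).
  apply: (@le_trans _ _ (\int[mu]_t (2 * t ^+ 2))).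
    apply: le_Rintegral => //; [|exact: (integrableRZ _ i2)].
    exact: (integrable_norm ippB).
  by rewrite RintegralZl// ler_pM2l.
have P1 : `|Pm| <= 1.
  apply: (le_trans (le_normr_Rintegral measurableT ip)).
  rewrite -[leRHS](Rintegral_cst_prob s); apply: le_Rintegral => //.
    exact: (integrable_norm ip).
  exact: integrable_cst_prob.
have p2 : p0 ^+ 2 <= Pm ^+ 2 + 3 * s ^+ 2.
  have h3 : `|p0| <= `|Pm| + s ^+ 2.
    by rewrite -[p0](subrKC Pm) (le_trans (ler_normD _ _))// lerD2l distrC.
  have : p0 ^+ 2 <= (`|Pm| + s ^+ 2) ^+ 2.
    by rewrite -sqrn ler_pXn2r ?nnegrE// addr_ge0// ltW.
  rewrite -(sqrn Pm); have := normr_ge0 Pm; nra.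
have s4 : s ^+ 4 = s ^+ 2 * s ^+ 2 by rewrite -exprD.
have := ler_wpM2r (ltW s20) p2; rewrite s4 in h2le *; nra.
Qed.

End gaussian_variance.

(** * Integrating out one coupling *)

Section decoupling.
Context {R : realType} {d : measure_display} {T : measurableType d}
  {P : probability T R} {E : finType} (g : E -> {RV P >-> R}).
Hypothesis indep_g : mutually_independent g.

Definition restrict (S : {set E}) (x : E -> R) : E -> R :=
  fun f => if f \in S then x f else 0.

(* Measurability for the product sigma-algebra on [R * (E -> R)], tested by
   composition so that no measurable structure on [E -> R] is needed. *)
Definition jointly_measurable (psi : R -> (E -> R) -> R) : Prop :=
  forall (d' : measure_display) (T' : measurableType d') (t : T' -> R)
    (x : E -> T' -> R),
    measurable_fun setT t -> (forall f, measurable_fun setT (x f)) ->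
    measurable_fun setT (fun z => psi (t z) (fun f => x f z)).

(** A pi-system on [T] that generates the sigma-algebra of the couplings in [S]. *)
Let cylinder (S : {set E}) : set (set T) :=
  [set A | exists2 B : E -> set R, (forall f, measurable (B f)) &
           A = \bigcap_(f in [set` S]) (g f @^-1` B f)].

Let measurable_preimage f (B : set R) : measurable B -> measurable (g f @^-1` B).
Proof. by move=> mB; rewrite -[X in measurable X]setTI; exact: measurable_funP. Qed.

Let cylinder_measurable S : cylinder S `<=` measurable.
Proof.
move=> A [B mB ->]; apply: fin_bigcap_measurable => [|f _].
  exact: finite_finset.
exact: measurable_preimage.
Qed.

Let cylinderI S : setI_closed (cylinder S).
Proof.
move=> A A' [B mB ->] [B' mB' ->]; exists (fun f => B f `&` B' f).
  by move=> f; exact: measurableI.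
by rewrite -bigcapI.
Qed.

Let cylinderT S : cylinder S setT.
Proof.
exists (fun=> setT) => //; apply/seteqP; split => // w _ f _ //.
Qed.

Let cylinder_indep (S : {set E}) (e : E) (A : set T) (B : set R) :
  e \notin S -> cylinder S A -> measurable B ->
  (P (A `&` g e @^-1` B) = P A * P (g e @^-1` B))%E.
Proof.
move=> eS [C mC ->] mB.
pose D f := if f == e then B else C f.
have mD f : measurable (D f) by rewrite /D; case: eqP.
have CD : \bigcap_(f in [set` S]) (g f @^-1` C f) =
          \bigcap_(f in [set` S]) (g f @^-1` D f).
  apply: eq_bigcapr => f /= fS; rewrite /D; case: eqP => // fe.
  by rewrite fe (negbTE eS) in fS.
have De : D e = B by rewrite /D eqxx.
have -> : \bigcap_(f in [set` S]) (g f @^-1` C f) `&` g e @^-1` B =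
          \bigcap_(f in [set` e |: S]) (g f @^-1` D f).
  rewrite CD -De; apply/seteqP; split => w /=.
    by move=> [h1 h2] f /=; rewrite in_setU1 => /orP[/eqP->//|]; exact: h1.
  move=> h; split; last by apply: h => /=; rewrite setU11.
  by move=> f fS; apply: h => /=; rewrite in_setU1 fS orbT.
by rewrite indep_g// big_setU1//= -indep_g// -CD De muleC.
Qed.

(** For fixed [B] both sides are finite measures in [A], a restriction and a multiple of [P], that
    agree on the pi-system of cylinders. *)
Let sigma_indep (S : {set E}) (e : E) (A : set T) (B : set R) :
  e \notin S -> <<s cylinder S >> A -> measurable B ->
  (P (A `&` g e @^-1` B) = P A * P (g e @^-1` B))%E.
Proof.
move=> eS sA mB; have mge := measurable_preimage e mB.
have Pge : P (g e @^-1` B) \is a fin_num by exact: fin_num_measure.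
have c0 : 0 <= fine (P (g e @^-1` B)) by rewrite fine_ge0.
pose m1 := mrestr P mge; pose m2 := mscale (NngNum c0) P.
have m2E A' : m2 A' = (P A' * P (g e @^-1` B))%E.
  by rewrite muleC -[X in (X * _)%E](fineK Pge).
have : m1 A = m2 A.
  apply: (g_sigma_algebra_measure_unique (cylinder S)
    (@cylinder_measurable S) (fun=> setT) (fun=> cylinderT S) _ m1 m2
    (@cylinderI S)) => //.
  - by rewrite bigcup_const//; exists 0%N.
  - by move=> A' cA'; apply: (etrans (cylinder_indep eS cA' mB)).
  - move=> n; change (P (setT `&` g e @^-1` B) < +oo)%E.
    by rewrite setTI ltey_eq Pge.
by move=> h; apply: (etrans h).
Qed.

(** Fubini for the couplings in [S] jointly with [g e]. The whole family on [S] is represented by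
    the identity from [T] to [T] with the coarser sigma-algebra of [S]; by independence its pair
    with [g e] has a product law. *)
Lemma decoupling (S : {set E}) (e : E) (psi : R -> (E -> R) -> R) :
  e \notin S -> jointly_measurable psi ->
  P.-integrable setT
    (EFin \o (fun w => psi (g e w) (restrict S (fun f => g f w)))) ->
  (forall t, P.-integrable setT
    (EFin \o (fun w => psi t (restrict S (fun f => g f w))))) ->
  measurable_fun [set: R]
    (fun t => \int[P]_w psi t (restrict S (fun f => g f w))) /\
  \int[P]_w psi (g e w) (restrict S (fun f => g f w)) =
  \int[distribution P (g e)]_t \int[P]_w psi t (restrict S (fun f => g f w)).
Proof.
move=> eS mpsi ipsi ipsit.
pose T0 := g_sigma_algebraType (cylinder S).
have mid : measurable_fun [set: T] (idfun : T -> T0).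
  move=> _ A mA; rewrite setTI preimage_id.
  by apply: (@smallest_sub _ (sigma_algebra setT) (cylinder S) measurable _ _ A mA);
    [exact: sigma_algebra_measurable|exact: cylinder_measurable].
pose mid_mixin := isMeasurableFun.Build _ _ _ _ _ mid.
pose X0 : {mfun T >-> T0} := HB.pack (idfun : T -> T0) mid_mixin.
pose P0 : probability T0 R := distribution P X0.
pose nu : probability R R := distribution P (g e).
have mphi : measurable_fun [set: T] (fun w => (w : T0, g e w)).
  by apply: measurable_fun_pair => //; exact: measurable_funP.
pose mphi_mixin := isMeasurableFun.Build _ _ _ _ _ mphi.
pose Xp : {mfun T >-> (T0 * R)%type} := HB.pack (fun w => (w : T0, g e w)) mphi_mixin.
pose Pp : probability (T0 * R)%type R := distribution P Xp.
pose f (z : T0 * R) : \bar R := (psi z.2 (restrict S (fun f => g f z.1)))%:E.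
have mg f0 : f0 \in S -> measurable_fun [set: T0] (g f0 : T0 -> R).
  move=> f0S _ B mB; rewrite setTI; apply: sub_sigma_algebra.
  exists (fun f' => if f' == f0 then B else setT).
    by move=> f'; case: eqP.
  apply/seteqP; split => w /=; last by move=> /(_ f0 f0S) /=; rewrite eqxx.
  by move=> Bw f' _ /=; case: eqP => // ->.
have mf : measurable_fun [set: T0 * R] f.
  apply/measurable_EFinP.
  apply: (@mpsi _ (T0 * R)%type snd (fun f0 z => restrict S (fun f => g f z.1) f0)).
    exact: measurable_snd.
  move=> f0; rewrite /restrict; have [f0S|f0S] := boolP (f0 \in S).
    by apply: (measurableT_comp (mg _ f0S)); exact: measurable_fst.
  exact: measurable_cst.
have PpE A : measurable A -> Pp A = (P0 \x nu)%E A.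
  move=> mA; apply/esym; apply: product_measure_unique => // B C mB mC.
  exact: (@sigma_indep S e B C eS mB mC).
have intf : Pp.-integrable setT f.
  exact: integrable_pushforward.
have intf' : (P0 \x nu)%E.-integrable setT f.
  apply/integrableP; split => //; rewrite (eq_measure_integral Pp).
    by case/integrableP: intf.
  by move=> A mA _; exact/esym/PpE.
have GE t : fubini_G P0 f t = (\int[P]_w psi t (restrict S (fun f => g f w)))%:E.
  rewrite /fubini_G integral_distribution.
  - by rewrite fineK//; exact: integrable_fin_num (ipsit t).
  - apply/measurable_EFinP.
    apply: (@mpsi _ T0 (cst t) (fun f0 y => restrict S (fun f => g f y) f0)) => //.
    move=> f0; rewrite /restrict; have [f0S|f0S] := boolP (f0 \in S).
      exact: mg.
    exact: measurable_cst.
  - exact: ipsit.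
split.
  by apply/measurable_EFinP; have := measurable_fubini_G intf'; rewrite (funext GE).
rewrite /Rintegral; congr fine.
transitivity (\int[Pp]_z f z)%E; first by rewrite integral_distribution.
transitivity (\int[(P0 \x nu)]_z f z)%E.
  by apply: eq_measure_integral => A mA _; exact: PpE.
by rewrite -integral21_prod_meas1//; apply: eq_integral => t _; exact: GE.
Qed.

End decoupling.

(** * Exponential square of a sum of random signs *)

Section cosh_bound.
Context {R : realType}.
Implicit Types y : R.

Lemma ge0_derive_le (f df : R -> R) (a b : R) :
  (forall x : R, is_derive x 1 f (df x)) -> a <= b ->
  (forall x, a <= x -> x <= b -> 0 <= df x) -> f a <= f b.
Proof.
move=> fdf ab df0.
have cf : continuous f.
  by move=> x; apply/differentiable_continuous/derivable1_diffP; case: (fdf x).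
have [c] := MVT_segment ab (fun x _ => fdf x) (continuous_subspaceT cf).
rewrite in_itv/= => /andP[ac cb] h; rewrite -subr_ge0 h mulr_ge0 ?df0//.
by rewrite subr_ge0.
Qed.

Lemma is_derive_ln_ch y : is_derive y 1 (fun x => ln (ch x)) (th y).
Proof.
rewrite [th y]mulrC.
exact: (is_derive1_comp (is_derive1_ln (ch_gt0 y)) (is_derive_ch y)).
Qed.

(** A rational upper bound for tanh. For eta <= 1/8 it is at most (1 - eta) y as soon as y^2 >= 6
    eta. *)
Lemma sh_rational_le y : 0 <= y ->
  (1 + 4 / 3 * y ^+ 2) * sh y <= y * (1 + y ^+ 2) * ch y.
Proof.
move=> y0; rewrite -subr_ge0.
pose h (x : R) := x * (1 + x ^+ 2) * ch x - (1 + 4 / 3 * x ^+ 2) * sh x.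
pose dh (x : R) := 5 / 3 * (x * (x * ch x - sh x)) + x ^+ 2 * (x * sh x).
have : h 0 <= h y.
  apply: (@ge0_derive_le h dh) => // x.
    have dc := is_derive_ch x; have ds := is_derive_sh x.
    by apply: is_derive_eq; rewrite /GRing.scale/= /dh; field.
  move=> x0 _; rewrite addr_ge0//; last by rewrite mulr_ge0 ?sqr_ge0 ?mulr_sh_ge0.
  by rewrite mulr_ge0// mulr_ge0// subr_ge0 sh_le.
by rewrite /h sh0 mul0r mulr0 mul0r subr0.
Qed.

Lemma ln_ch_le y : ln (ch y) <= y ^+ 2 / 2.
Proof.
wlog y0 : y / 0 <= y.
  move=> h; have [|yn] := leP 0 y; first exact: h.
  by rewrite -chN -sqrrN h// oppr_ge0 ltW.
rewrite -subr_ge0; pose f (x : R) := x ^+ 2 / 2 - ln (ch x).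
have : f 0 <= f y.
  apply: (@ge0_derive_le f (fun x => x - th x)) => // x.
    have dl := is_derive_ln_ch x.
    by apply: is_derive_eq; rewrite /GRing.scale/=; field.
  by move=> x0 _; rewrite subr_ge0 ler_pdivrMr ?ch_gt0// sh_le.
by rewrite /f ch0 ln1 expr0n/= mul0r subr0.
Qed.

(** While y^2 <= 6 eta, passing from y^2 / 2 to (1 - eta) y^2 / 2 loses at most 3 eta^2. Beyond that
    point tanh y <= (1 - eta) y, so the right-hand side grows at least as fast as the left. *)
Lemma ln_ch_le_improved (eta y : R) : 0 <= eta -> eta <= 1 / 8 ->
  ln (ch y) <= (1 - eta) * y ^+ 2 / 2 + 3 * eta ^+ 2.
Proof.
move=> e0 e8.
wlog y0 : y / 0 <= y.
  move=> h; have [|yn] := leP 0 y; first exact: h.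
  by rewrite -chN -sqrrN h// oppr_ge0 ltW.
have small z : z ^+ 2 <= 6 * eta ->
    ln (ch z) <= (1 - eta) * z ^+ 2 / 2 + 3 * eta ^+ 2.
  move=> hz; have := ln_ch_le z; have := ler_wpM2l e0 hz; lra.
pose y1 := Num.sqrt (6 * eta).
have y1E : y1 ^+ 2 = 6 * eta by rewrite sqr_sqrtr// mulr_ge0.
have y10 : 0 <= y1 by exact: sqrtr_ge0.
have [yy1|y1y] := leP y y1.
  by apply: small; rewrite -y1E ler_pXn2r ?nnegrE.
pose f (x : R) := (1 - eta) * x ^+ 2 / 2 + 3 * eta ^+ 2 - ln (ch x).
rewrite -subr_ge0; apply: (@le_trans _ _ (f y1)).
  by rewrite subr_ge0 small// y1E.
apply: (@ge0_derive_le f (fun x => (1 - eta) * x - th x)); last 2 first.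
- exact: ltW.
- move=> x x1 _; have x0 : 0 <= x by exact: le_trans x1.
  have x2 : 6 * eta <= x ^+ 2 by rewrite -y1E ler_pXn2r ?nnegrE.
  rewrite subr_ge0 ler_pdivrMr ?ch_gt0//.
  have d0 : 0 < 1 + 4 / 3 * x ^+ 2 by rewrite ltr_pwDl// mulr_ge0 ?sqr_ge0.
  rewrite -(ler_pM2l d0); apply: (le_trans (sh_rational_le x0)).
  rewrite [leRHS]mulrA ler_pM2r ?ch_gt0//.
  rewrite [leRHS](_ : _ = x * ((1 + 4 / 3 * x ^+ 2) * (1 - eta))); last by ring.
  by rewrite ler_wpM2l//; have := ler_wpM2r (sqr_ge0 x) e8; lra.
move=> x; have dl := is_derive_ln_ch x.
by apply: is_derive_eq; rewrite /GRing.scale/=; field.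
Qed.

End cosh_bound.

Section rademacher_square.
Context {R : realType}.

Lemma normal_exp_square (sigma : R) : 0 < sigma ->
  (\int[normal_prob 0 1]_x (expR ((1 - sigma ^- 2) * x ^+ 2 / 2))%:E = sigma%:E)%E.
Proof.
move=> s0; rewrite ge0_integral_normal_prob; last 2 first.
- apply/measurable_EFinP; apply: measurableT_comp => //.
  by apply: measurable_funM => //; apply: measurable_funM => //; exact: measurable_funX.
- by move=> x; rewrite lee_fin expR_ge0.
have sn0 : sigma != 0 by rewrite gt_eqF.
transitivity (\int[lebesgue_measure]_x (sigma%:E * (normal_pdf 0 sigma x)%:E))%E.
  apply: eq_integral => x _; rewrite -!EFinM; congr EFin.
  rewrite !normal_pdf_peak// /normal_fun [LHS]mulrCA [RHS]mulrA -expRD.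
  have -> : normal_peak 1 = sigma * normal_peak sigma.
    rewrite /normal_peak expr1n mul1r -mulrnAr sqrtrM ?sqr_ge0// sqrtr_sqr gtr0_norm//.
    by rewrite invfM mulrA divff// mul1r.
  by congr (_ * expR _); field.
rewrite integralZl//=; last exact: integrable_normal_pdf.
by rewrite integral_normal_pdf mule1.
Qed.

Lemma sum_expR_spin (N : nat) (y : R) :
  (2 ^+ N)^-1 * (\sum_(s : {ffun 'I_N -> bool}) expR (y * \sum_i spin R (s i))) =
  ch y ^+ N.
Proof.
under eq_bigr do rewrite mulr_sumr expR_sum.
rewrite -(bigA_distr_bigA (fun (i : 'I_N) b => expR (y * spin R b))).
rewrite prodr_const card_ord -exprVn -exprMn; congr (_ ^+ _).
by rewrite big_bool /ch /spin expr1 expr0 mulr1 mulrN1 addrC mulrC.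
Qed.

Lemma ln_sum_expR_spin_square (N : nat) : (0 < N)%N ->
  ln ((2 ^+ N)^-1 * \sum_(s : {ffun 'I_N -> bool})
        expR ((\sum_i spin R (s i)) ^+ 2 / (2 * N%:R)))
  <= 4^-1 * ln N%:R + 5.
Proof.
move=> N0; have n0 : 0 < N%:R :> R by rewrite ltr0n.
have n1 : 1 <= N%:R :> R by rewrite ler1n.
pose q : R := Num.sqrt N%:R; have q0 : 0 < q by rewrite sqrtr_gt0.
have q2 : q ^+ 2 = N%:R by rewrite sqr_sqrtr// ltW.
have q1 : 1 <= q by rewrite -(@ler_pXn2r _ 2) ?nnegrE ?(ltW q0)// q2 expr1n.
(* This gives eta = 1 / (8 sqrt N), which is at most 1/8 and has N eta^2 = 1/64. The N-fold
   correction e^(3 N eta^2) thus stays below e, while sigma is of order N^(1/4). *)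
pose sigma : R := Num.sqrt (8 * q).
have s0 : 0 < sigma by rewrite sqrtr_gt0 mulr_gt0.
have s2 : sigma ^+ 2 = 8 * q by rewrite sqr_sqrtr// mulr_ge0 ?ltW.
pose eta := sigma ^- 2.
have e0 : 0 <= eta by rewrite invr_ge0 sqr_ge0.
have e8 : eta <= 1 / 8.
  by rewrite /eta s2 mul1r lef_pV2 ?posrE ?mulr_gt0//; lra.
have Ne : N%:R * eta ^+ 2 <= 1 / 64.
  by rewrite /eta s2 -q2 [leLHS](_ : _ = 1 / 64)//; field; rewrite gt_eqF.
set A := (X in ln X).
have A0 : 0 < A.
  rewrite mulr_gt0 ?invr_gt0 ?exprn_gt0//.
  rewrite (bigD1 [ffun=> false])//= ltr_pwDl ?expR_gt0//.
  by apply: sumr_ge0 => i _; exact: expR_ge0.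
pose mu : probability (measurableTypeR R) R := normal_prob 0 1.
have lt01 := @ltr01 R.
have iS (S : R) := integrable_normal_expR lt01 (S / q).
have iC : mu.-integrable [set: R] (EFin \o (fun z => ch (z / q) ^+ N)).
  have := integrableRZ (2 ^+ N)^-1 (integrableR_sum (index_enum {ffun 'I_N -> bool})
    (fun s => iS (\sum_i spin R (s i)))).
  apply: eq_integrable => // z _; rewrite /= -sum_expR_spin.
  by congr ((_ * _)%:E); apply: eq_bigr => s _; congr expR; ring.
(* Hubbard-Stratonovich: e^(S^2 / (2 N)) is the mean of e^(S z / q) over a standard Gaussian z. *)
have AE : A = \int[mu]_z (ch (z / q) ^+ N).
  transitivity (\int[mu]_z ((2 ^+ N)^-1 * \sum_(s : {ffun 'I_N -> bool})
      expR ((\sum_i spin R (s i)) / q * z))).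
    rewrite RintegralZl//; last by apply: integrableR_sum => s; exact: iS.
    rewrite Rintegral_sum; last by move=> s; exact: iS.
    congr (_ * _); apply: eq_bigr => s _.
    rewrite Rintegral_normal_expR// -q2; congr expR.
    by field; rewrite gt_eqF.
  apply: eq_Rintegral => z _; rewrite -sum_expR_spin.
  by congr (_ * _); apply: eq_bigr => s _; congr expR; ring.
have iG : mu.-integrable [set: R]
    (EFin \o (fun x => expR ((1 - sigma ^- 2) * x ^+ 2 / 2))).
  apply/integrableP; split.
    apply/measurable_EFinP; apply: measurableT_comp => //.
    by apply: measurable_funM => //; apply: measurable_funM => //; exact: measurable_funX.
  under eq_integral do rewrite /= ger0_norm ?expR_ge0//.
  by rewrite normal_exp_square// ltry.
have Ale : A <= expR 1 * sigma.
  have -> : sigma = \int[mu]_x expR ((1 - sigma ^- 2) * x ^+ 2 / 2).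
    by rewrite /Rintegral normal_exp_square.
  rewrite AE -RintegralZl//; apply: le_Rintegral => //; first exact: integrableRZ.
  move=> x _; rewrite -expRD.
  have -> : ch (x / q) = expR (ln (ch (x / q))) by rewrite lnK// posrE ch_gt0.
  rewrite -expRM_natl ler_expR.
  have := ler_wpM2l (ltW n0) (ln_ch_le_improved (x / q) e0 e8).
  have -> : N%:R * ((1 - eta) * (x / q) ^+ 2 / 2 + 3 * eta ^+ 2) =
     (1 - eta) * x ^+ 2 / 2 + 3 * (N%:R * eta ^+ 2).
    by rewrite -q2; field; rewrite gt_eqF.
  rewrite -/eta; lra.
apply: (@le_trans _ _ (ln (expR 1 * sigma))).
  by rewrite ler_ln ?posrE// mulr_gt0 ?expR_gt0.
rewrite lnM ?posrE ?expR_gt0// expRK.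
have l2 (x : R) : 0 < x -> ln (x ^+ 2) = 2 * ln x.
  by move=> x0; rewrite lnXn// mulr_natl.
have : 2 * ln sigma = ln 8 + ln q by rewrite -l2// s2 lnM ?posrE.
have : 2 * ln q = ln N%:R by rewrite -l2// q2.
(* Since ln 8 <= 8, the additive constant is at most 1 + 8 / 2 = 5. *)
have := @ln_sublinear R 8 (ltr0n _ _); lra.
Qed.

End rademacher_square.

(** * Gibbs averages *)

Lemma set_ind_add (E : finType) (Q : {set E} -> Prop) :
  Q finset.set0 ->
  (forall (S : {set E}) e, e \notin S -> Q S -> Q (e |: S)) -> forall S, Q S.
Proof.
move=> Q0 QS S; have [n] := ubnP #|S|; elim: n S => // n ih S Sn.
have [->//|[e eS]] := set_0Vmem S.
rewrite -(finset.setD1K eS); apply: QS; first by rewrite !inE eqxx.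
by apply: ih; move: Sn; rewrite (cardsD1 e S) eS.
Qed.

Section gibbs.
Context {R : realType} {E I : finType} (w : I -> R) (k : I -> E -> R) (i0 : I).
Hypothesis w_gt0 : forall i, 0 < w i.
Hypothesis k_pm1 : forall i e, k i e ^+ 2 = 1.
Implicit Types (x y z : E -> R) (e f : E) (t : R) (S : {set E}).

(** [k i e] stands for the product of the two spins of configuration [i] on edge [e]; until the
    overlaps are estimated, all that matters is that it is a sign. *)
Definition energy x i := \sum_e x e * k i e.
Definition weight x i := w i * expR (energy x i).
Definition log_partition x := ln (\sum_i weight x i).
Definition gibbs_mean x e := (\sum_i weight x i * k i e) / \sum_i weight x i.
Definition shift x e t : E -> R := fun f => x f + (if f == e then t else 0).

Lemma weight_gt0 x i : 0 < weight x i.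
Proof. by rewrite mulr_gt0 ?expR_gt0. Qed.

Lemma energy_shift x e t i : energy (shift x e t) i = energy x i + k i e * t.
Proof.
rewrite /energy /shift; under eq_bigr do rewrite mulrDl.
rewrite big_split/=; congr (_ + _); rewrite (bigD1 e)//= eqxx big1 ?addr0 1?mulrC//.
by move=> f /negbTE->; rewrite mul0r.
Qed.

Lemma weight_shift x e t i : weight (shift x e t) i = weight x i * expR (k i e * t).
Proof. by rewrite /weight energy_shift expRD mulrA. Qed.

Lemma log_partition_shift x e t :
  log_partition (shift x e t) = lse (weight x) (k^~ e) t.
Proof. by congr ln; apply: eq_bigr => i _; rewrite weight_shift. Qed.

Lemma gibbs_mean_shift x e t :
  gibbs_mean (shift x e t) e = gmean (weight x) (k^~ e) t.
Proof. by congr (_ / _); apply: eq_bigr => i _; rewrite weight_shift. Qed.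

Lemma shift0 x e : shift x e 0 = x.
Proof. by apply/funext => f; rewrite /shift if_same addr0. Qed.

Lemma gibbs_mean_gmean x e : gibbs_mean x e = gmean (weight x) (k^~ e) 0.
Proof. by rewrite -gibbs_mean_shift shift0. Qed.

Lemma gibbs_mean_le1 x e : `|gibbs_mean x e| <= 1.
Proof.
rewrite gibbs_mean_gmean; apply: (gmean_norm_le i0 (weight_gt0 x)) => i.
by rewrite (@pm1_norm _ _ (k^~ e)).
Qed.

(** Jensen's inequality under the Gibbs weights at [x]: convexity, with [gibbs_mean] as gradient. *)
Lemma log_partition_tangent x y :
  log_partition x + \sum_e gibbs_mean x e * (y e - x e) <= log_partition y.
Proof.
have := ln_sum_expR_ge i0 (weight_gt0 x) (fun i => energy y i - energy x i).
rewrite (_ : \sum_i weight x i * expR _ = \sum_i weight y i); last first.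
  apply: eq_bigr => i _; rewrite /weight -mulrA -expRD; congr (_ * expR _); ring.
apply: le_trans; rewrite lerD2l -subr_ge0 (_ : _ - _ = 0)//; apply/eqP; rewrite subr_eq0; apply/eqP.
rewrite mulr_suml.
under [RHS]eq_bigr do rewrite /gibbs_mean mulrAC mulr_suml mulr_suml.
rewrite exchange_big/=; apply: eq_bigr => i _.
rewrite -mulr_suml; congr (_ / _); rewrite -sumrB mulr_sumr.
by apply: eq_bigr => e _; ring.
Qed.

Lemma log_partition_lip x y :
  `|log_partition x - log_partition y| <= \sum_e `|x e - y e|.
Proof.
have key u v : log_partition u - log_partition v <= \sum_e `|u e - v e|.
  have := log_partition_tangent u v; rewrite -lerBrDl => h.
  rewrite -lerN2 opprB (le_trans _ h)// -sumrN ler_sum// => e _.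
  rewrite lerNl -mulrN opprB (le_trans (ler_norm _))// normrM ler_piMl//.
  exact: gibbs_mean_le1.
rewrite ler_norml key andbT lerNl opprB (le_trans (key _ _))//.
by under eq_bigr do rewrite distrC.
Qed.

Lemma measurable_log_partition d (T : measurableType d) (X : E -> T -> R) :
  (forall e, measurable_fun [set: T] (X e)) ->
  measurable_fun [set: T] (fun v => log_partition (fun e => X e v)).
Proof.
move=> mx; apply: measurableT_comp => //.
apply: measurable_sum => i; apply: measurable_funM => //.
apply: measurableT_comp => //; apply: measurable_sum => e.
exact: measurable_funM.
Qed.

Lemma measurable_gibbs_mean d (T : measurableType d) (X : E -> T -> R) f :
  (forall e, measurable_fun [set: T] (X e)) ->
  measurable_fun [set: T] (fun v => gibbs_mean (fun e => X e v) f).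
Proof.
(* Dividing by Z is multiplying by exp (- ln Z), whose measurability is known. *)
move=> mx; rewrite [X in measurable_fun _ X](_ : _ = fun v =>
  (\sum_i weight (fun e => X e v) i * k i f) *
  expR (- log_partition (fun e => X e v))); last first.
  apply/funext => v; rewrite expRN lnK// posrE.
  exact: (wtot_gt0 i0 (weight_gt0 _)).
apply: measurable_funM; last first.
  apply: measurableT_comp => //; apply: measurableT_comp => //.
  exact: measurable_log_partition.
apply: measurable_sum => i; apply: measurable_funM => //.
apply: measurable_funM => //.
apply: measurableT_comp => //; apply: measurable_sum => e.
exact: measurable_funM.
Qed.

Lemma measurable_shift d (T : measurableType d) (X : E -> T -> R) (u : T -> R) e f :
  (forall e, measurable_fun [set: T] (X e)) -> measurable_fun [set: T] u ->
  measurable_fun [set: T] (fun v => shift (fun e => X e v) e (u v) f).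
Proof.
by move=> mx mt; rewrite /shift; case: eqP => _; apply: measurable_funD.
Qed.

End gibbs.

(** * Edge-by-edge interpolation *)

Lemma ler_norm_dist {R : realType} (a b r : R) : `|a - b| <= r -> `|a| <= `|b| + r.
Proof.
by move=> h; rewrite -[a](subrKC b) (le_trans (ler_normD _ _))// lerD2l.
Qed.

Lemma ler_sqr_dist {R : realType} (a b r : R) :
  `|a - b| <= r -> a ^+ 2 <= 2 * b ^+ 2 + 2 * r ^+ 2.
Proof.
move=> h; have : (a - b) ^+ 2 <= r ^+ 2.
  by rewrite -sqrn ler_pXn2r ?nnegrE// (le_trans _ h).
have := sqr_ge0 (a - 2 * b); nra.
Qed.

Section disorder.
Context {R : realType} {E I : finType} (w : I -> R) (k : I -> E -> R) (i0 : I).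
Hypothesis w_gt0 : forall i, 0 < w i.
Hypothesis k_pm1 : forall i e, k i e ^+ 2 = 1.
Context {d : measure_display} {T : measurableType d} {P : probability T R}
  (g : E -> {RV P >-> R}) (s : R).
Hypothesis s_gt0 : 0 < s.
Hypothesis s_le1 : s <= 1.
Hypothesis g_law : forall e (A : set R), measurable A ->
  distribution P (g e) A = normal_prob 0 s A.
Hypothesis g_indep : mutually_independent g.
Implicit Types (x y z : E -> R) (e f : E) (t : R) (S : {set E}) (v : T).

Let mu : probability (measurableTypeR R) R := normal_prob 0 s.
Local Notation integ h := (mu.-integrable [set: R] (EFin \o h)).
Local Notation integP h := (P.-integrable [set: T] (EFin \o h)).
Local Notation F := (log_partition w k).
Local Notation m := (gibbs_mean w k).

(** [x] holds the couplings already revealed, drifts included, and those in [S] are still random;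
    averaging over [v] is then a conditional expectation. *)
Definition offset x S v : E -> R := fun f => x f + restrict S (fun e => g e v) f.

Definition avg (h : (E -> R) -> R) S x := \int[P]_v h (offset x S v).

Lemma offset_shift x e t S v : offset (shift x e t) S v = shift (offset x S v) e t.
Proof. by apply/funext => f; rewrite /offset /shift addrAC. Qed.

Lemma offset_setU1 x e S v : e \notin S ->
  offset x (e |: S) v = shift (offset x S v) e (g e v).
Proof.
move=> eS; apply/funext => f; rewrite /offset /shift /restrict in_setU1.
by case: eqP => [->|_]; rewrite ?(negbTE eS)/= ?addr0.
Qed.

Lemma offset_set0 x v : offset x finset.set0 v = x.
Proof. by apply/funext => f; rewrite /offset /restrict inE addr0. Qed.

Lemma offset_setT v : offset (fun=> 0) finset.setT v = fun f => g f v.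
Proof. by apply/funext => f; rewrite /offset /restrict inE add0r. Qed.

Lemma measurable_offset x S f : measurable_fun [set: T] (fun v => offset x S v f).
Proof.
rewrite /offset /restrict; apply: measurable_funD => //.
by have [fS|fS] := boolP (f \in S); [exact: measurable_funP|exact: measurable_cst].
Qed.

(* [distribution P (g e)] and [normal_prob 0 s] live on two copies of the Borel
   sigma-algebra of [R] that carry different displays. *)
Let integral_law e (h : R -> \bar R) : measurable_fun [set: R] h ->
  (\int[distribution P (g e)]_t h t = \int[normal_prob 0 s]_t h t)%E.
Proof.
have mid : measurable_fun [set: measurableTypeR R] (idfun : measurableTypeR R -> R).
  by move=> _ A mA; rewrite setTI preimage_id.
have key (h' : R -> \bar R) : measurable_fun [set: R] h' -> (forall t, 0 <= h' t)%E ->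
    (\int[distribution P (g e)]_t h' t = \int[normal_prob 0 s]_t h' t)%E.
  move=> mh h0; transitivity (\int[pushforward mu (idfun : measurableTypeR R -> R)]_t h' t)%E.
    by apply: eq_measure_integral => A mA _; exact: g_law.
  by rewrite ge0_integral_pushforward.
move=> mh; rewrite integralE [RHS]integralE; congr (_ - _)%E; apply: key => //.
  exact: measurable_funepos.
exact: measurable_funeneg.
Qed.

Let integrable_g2 e : integP (fun v => g e v ^+ 2).
Proof.
have mg : measurable_fun [set: T] (g e) by exact: measurable_funP.
apply/integrableP; split.
  by apply/measurable_EFinP; exact: measurable_funX.
have := integrable_normal_exprn s_gt0 2 => /integrableP[_].
have mX : measurable_fun [set: R] (fun t : R => `|(t ^+ 2)%:E|%E).
  apply: measurableT_comp => //; apply/measurable_EFinP; exact: measurable_funX.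
by rewrite -(integral_law e mX) ge0_integral_distribution.
Qed.

Let integrable_sum_g : integP (fun v => \sum_e (1 + g e v ^+ 2)).
Proof.
apply: integrableR_sum => e; apply: integrableRD => //.
exact: finite_measure_integrable_cst.
Qed.

Let dist_offset x S v : `|F (offset x S v) - F x| <= \sum_e `|g e v|.
Proof.
apply: (le_trans (log_partition_lip i0 w_gt0 k_pm1 _ _)); apply: ler_sum => e _.
rewrite /offset addrAC subrr add0r /restrict; case: ifP => // _.
by rewrite normr0.
Qed.

Lemma integrable_log_partition S x : integP (fun v => F (offset x S v)).
Proof.
have iD : integP (fun v => `|F x| + \sum_e (1 + g e v ^+ 2)).
  by apply: integrableRD => //; exact: finite_measure_integrable_cst.
apply: le_integrable iD => //.
  apply/measurable_EFinP; apply: measurable_log_partition.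
  exact: measurable_offset.
move=> v _; rewrite /= lee_fin (le_trans _ (ler_norm _))//.
apply: (le_trans (ler_norm_dist (dist_offset x S v))).
rewrite lerD2l; apply: ler_sum => e _.
rewrite -sqrn; have := normr_ge0 (g e v); nra.
Qed.

Lemma integrable_log_partition2 S x : integP (fun v => F (offset x S v) ^+ 2).
Proof.
have iD : integP (fun v => 2 * F x ^+ 2 +
    2 * (\sum_e \sum_f (g e v ^+ 2 + g f v ^+ 2))).
  apply: integrableRD => //; first exact: finite_measure_integrable_cst.
  apply: integrableRZ; apply: integrableR_sum => e; apply: integrableR_sum => f.
  exact: integrableRD.
apply: le_integrable iD => //.
  apply/measurable_EFinP; apply: measurable_funX; apply: measurable_log_partition.
  exact: measurable_offset.
move=> v _; rewrite /= lee_fin (le_trans _ (ler_norm _))//.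
rewrite ger0_norm ?sqr_ge0//.
apply: (le_trans (ler_sqr_dist (dist_offset x S v))).
rewrite lerD2l ler_pM2l//.
rewrite expr2 mulr_suml; apply: ler_sum => e _.
rewrite mulr_sumr; apply: ler_sum => f _.
rewrite -(sqrn (g e v)) -(sqrn (g f v)).
have := sqr_ge0 (`|g e v| - `|g f v|); have := sqr_ge0 `|g e v|.
have := sqr_ge0 `|g f v|; nra.
Qed.

Lemma integrable_gibbs_mean S f x : integP (fun v => m (offset x S v) f).
Proof.
have i1 : integP (fun=> 1 : R) by exact: finite_measure_integrable_cst.
apply: le_integrable i1 => //.
  apply/measurable_EFinP; apply: measurable_gibbs_mean => // e.
  exact: measurable_offset.
by move=> v _; rewrite /= lee_fin normr1 (gibbs_mean_le1 i0).
Qed.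

(** Tower property with [e] integrated outermost: it is revealed before the couplings in [S], so its
    drift may depend on [x] but not on them. *)
Lemma avg_step (h : (E -> R) -> R) S e x : e \notin S ->
  (forall d' (T' : measurableType d') (X : E -> T' -> R),
    (forall f, measurable_fun [set: T'] (X f)) ->
    measurable_fun [set: T'] (fun b => h (fun f => X f b))) ->
  (forall S' x', integP (fun v => h (offset x' S' v))) ->
  measurable_fun [set: R] (fun t => avg h S (shift x e t)) /\
  avg h (e |: S) x = \int[mu]_t avg h S (shift x e t).
Proof.
move=> eS mh ih.
pose psi t y := h (shift (fun f => x f + y f) e t).
have psiE t v : psi t (restrict S (fun f => g f v)) = h (offset (shift x e t) S v).
  by rewrite offset_shift.
have [||t|mpsi dec] := @decoupling R d T P E g g_indep S e psi eS.
- move=> d' T' u X mu' mX; apply: mh => f.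
  apply: (@measurable_shift R E d' T' (fun f' b => x f' + X f' b) u e f) => // f'.
  exact: measurable_funD.
- apply: eq_integrable (ih (e |: S) x) => // v _.
  by rewrite /= offset_setU1.
- by apply: eq_integrable (ih S (shift x e t)) => // v _; rewrite /= psiE.
have avgE t : \int[P]_v psi t (restrict S (fun f => g f v)) = avg h S (shift x e t).
  by apply: eq_Rintegral => v _; rewrite psiE.
split; first by rewrite -(funext avgE).
transitivity (\int[P]_v psi (g e v) (restrict S (fun f => g f v))).
  by apply: eq_Rintegral => v _; rewrite offset_setU1.
rewrite dec; under eq_Rintegral do rewrite avgE.
by congr fine; apply: integral_law; apply/measurable_EFinP; rewrite -(funext avgE).
Qed.

Let c S x := avg F S x.
Let q S x := avg (fun y => F y ^+ 2) S x.
Let dm S x f := avg (m^~ f) S x.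

Let c_step S e x : e \notin S ->
  measurable_fun [set: R] (fun t => c S (shift x e t)) /\
  c (e |: S) x = \int[mu]_t c S (shift x e t).
Proof.
move=> eS; apply: avg_step => //; last exact: integrable_log_partition.
by move=> d' T' X mX; exact: measurable_log_partition.
Qed.

Let q_step S e x : e \notin S ->
  measurable_fun [set: R] (fun t => q S (shift x e t)) /\
  q (e |: S) x = \int[mu]_t q S (shift x e t).
Proof.
move=> eS; apply: avg_step => //; last exact: integrable_log_partition2.
by move=> d' T' X mX; apply: measurable_funX; exact: measurable_log_partition.
Qed.

Let dm_step S e f x : e \notin S ->
  measurable_fun [set: R] (fun t => dm S (shift x e t) f) /\
  dm (e |: S) x f = \int[mu]_t dm S (shift x e t) f.
Proof.
move=> eS; apply: avg_step => //; last by move=> *; exact: integrable_gibbs_mean.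
by move=> d' T' X mX; exact: measurable_gibbs_mean.
Qed.

Let it1 (A : R) (h : R -> R) : 0 <= A -> measurable_fun [set: R] h ->
  (forall t, `|h t| <= A + `|t|) -> integ h.
Proof.
move=> A0 mh hA; apply: (@integrable_normal_poly _ s s_gt0 1 A 1) => // t.
by rewrite expr1 mul1r.
Qed.

Let lip_shift x e t : `|F (shift x e t) - F x| <= `|t|.
Proof.
rewrite -[X in _ - F X](shift0 x e) !log_partition_shift.
have kn i : `|k i e| <= 1 by rewrite (@pm1_norm _ _ (k^~ e)).
have := lse_lip i0 (weight_gt0 k w_gt0 x) 0 t kn.
by rewrite mul1r subr0.
Qed.

Let c_lip S x e t : `|c S (shift x e t) - c S x| <= `|t|.
Proof.
have iF := integrable_log_partition S.
rewrite /c /avg -(RintegralB measurableT (iF _) (iF _)).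
have iD := integrableRB (iF (shift x e t)) (iF x).
apply: (le_trans (le_normr_Rintegral measurableT iD)).
have -> : `|t| = \int[P]_v `|t|.
  by rewrite Rintegral_cst//= probability_setT mulr1.
apply: le_Rintegral => //; first exact: (integrable_norm iD).
  exact: finite_measure_integrable_cst.
by move=> v _; rewrite offset_shift lip_shift.
Qed.

Let c_integrable S e x : e \notin S -> integ (fun t => c S (shift x e t)).
Proof.
move=> eS; apply: (@it1 `|c S x|) => // [|t]; first by case: (c_step x eS).
exact: (ler_norm_dist (c_lip S x e t)).
Qed.

Let c2_integrable S e x : e \notin S -> integ (fun t => c S (shift x e t) ^+ 2).
Proof.
move=> eS; apply: (@integrable_normal_poly _ s s_gt0 2 (2 * c S x ^+ 2) 2) => // [|| t].
- by apply: measurable_funX; case: (c_step x eS).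
- by rewrite mulr_ge0// sqr_ge0.
rewrite ger0_norm ?sqr_ge0//; exact: (ler_sqr_dist (c_lip S x e t)).
Qed.

Let dm_le1 S x f : `|dm S x f| <= 1.
Proof.
have im := integrable_gibbs_mean S f x.
apply: (le_trans (le_normr_Rintegral measurableT im)).
have -> : 1 = \int[P]_v (1 : R).
  by rewrite Rintegral_cst//= probability_setT mulr1.
apply: le_Rintegral => //; first exact: (integrable_norm im).
  exact: finite_measure_integrable_cst.
by move=> v _; rewrite (gibbs_mean_le1 i0).
Qed.

Let dm_integrable S e f x : e \notin S -> integ (fun t => dm S (shift x e t) f).
Proof.
move=> eS; apply: (@it1 1) => // [|t]; first by case: (dm_step f x eS).
by rewrite (le_trans (dm_le1 _ _ _))// lerDl.
Qed.

Let q_integrable S e x : e \notin S -> integ (fun t => q S (shift x e t)).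
Proof.
move=> eS; apply: (@integrable_normal_poly _ s s_gt0 2 (2 * q S x) 2) => // [|| t].
- by case: (q_step x eS).
- by rewrite mulr_ge0//; apply: Rintegral_ge0 => v _; exact: sqr_ge0.
have iq := integrable_log_partition2 S.
rewrite ger0_norm; last by apply: Rintegral_ge0 => v _; exact: sqr_ge0.
have ic : integP (fun=> 2 * `|t| ^+ 2) by exact: finite_measure_integrable_cst.
have -> : 2 * q S x + 2 * `|t| ^+ 2 =
    \int[P]_v (2 * F (offset x S v) ^+ 2 + 2 * `|t| ^+ 2).
  rewrite (RintegralD measurableT (integrableRZ 2 (iq x)) ic).
  rewrite (RintegralZl 2 measurableT (iq x)).
  by rewrite Rintegral_cst//= probability_setT mulr1.
apply: le_Rintegral => //; first exact: (integrableRD (integrableRZ 2 (iq x)) ic).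
by move=> v _; rewrite offset_shift; exact: (ler_sqr_dist (lip_shift _ e t)).
Qed.

(** The bounds on odd and even parts hold for every realization with the same constants, so they
    survive averaging over [S]. With [dm] as slope, nothing has to be differentiated under the
    integral sign. *)
Let c_variance S e x : e \notin S ->
  \int[mu]_t (c S (shift x e t) ^+ 2) - c (e |: S) x ^+ 2 <=
  s ^+ 2 * dm (e |: S) x e ^+ 2 + 3200 * s ^+ 4.
Proof.
move=> eS; have [mc ->] := c_step x eS; have [md ->] := dm_step e x eS.
have iF := integrable_log_partition S; have im := integrable_gibbs_mean S e.
pose X v := offset x S v.
have w'0 v := weight_gt0 k w_gt0 (X v).
have k1 i := k_pm1 i e.
have iC (b : R) : integP (fun=> b) by exact: finite_measure_integrable_cst.
have intC (b : R) : \int[P]_v b = b by rewrite Rintegral_cst//= probability_setT mulr1.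
have bnd (h : T -> R) (b : R) : integP h -> (forall v, `|h v| <= b) -> `|\int[P]_v h v| <= b.
  move=> ih hb; apply: (le_trans (le_normr_Rintegral measurableT ih)).
  rewrite -[leRHS]intC; apply: le_Rintegral => //; exact: (integrable_norm ih).
have FE t v : F (offset (shift x e t) S v) = lse (weight w k (X v)) (k^~ e) t.
  by rewrite offset_shift log_partition_shift.
have mE t v : m (offset (shift x e t) S v) e = gmean (weight w k (X v)) (k^~ e) t.
  by rewrite offset_shift gibbs_mean_shift.
apply: (@gaussian_variance_le _ s s_gt0 (fun t => c S (shift x e t))
  (fun t => dm S (shift x e t) e) (dm S x e)) => //= [t|t|t|t].
- by rewrite shift0 c_lip.
- pose h v := F (offset (shift x e t) S v) - F (offset (shift x e (- t)) S v) -
    2 * t * m (offset x S v) e.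
  have i2 := integrableRB (iF (shift x e t)) (iF (shift x e (- t))).
  have i3 := integrableRZ (2 * t) (im x).
  have -> : c S (shift x e t) - c S (shift x e (- t)) - 2 * dm S x e * t =
      \int[P]_v h v.
    rewrite /h (RintegralB measurableT i2 i3) (RintegralB measurableT (iF _) (iF _)).
    by rewrite (RintegralZl (2 * t) measurableT (im x)) -/(dm S x e) (mulrAC 2).
  apply: bnd; first exact: (integrableRB i2 i3).
  move=> v; rewrite /h !FE gibbs_mean_gmean mulrAC.
  exact: (lse_pm1_odd i0 (w'0 v) k1).
- pose h v := F (offset (shift x e t) S v) + F (offset (shift x e (- t)) S v) -
    2 * F (offset x S v).
  have i2 := integrableRD (iF (shift x e t)) (iF (shift x e (- t))).
  have i3 := integrableRZ 2 (iF x).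
  have -> : c S (shift x e t) + c S (shift x e (- t)) - 2 * c S (shift x e 0) =
      \int[P]_v h v.
    rewrite /h (RintegralB measurableT i2 i3) (RintegralD measurableT (iF _) (iF _)).
    by rewrite (RintegralZl 2 measurableT (iF x)) shift0.
  apply: bnd; first exact: (integrableRB i2 i3).
  move=> v; rewrite /h !FE -[offset x S v](shift0 _ e) log_partition_shift.
  exact: (lse_pm1_even i0 (w'0 v) k1).
- pose h v := m (offset (shift x e t) S v) e + m (offset (shift x e (- t)) S v) e -
    2 * m (offset x S v) e.
  have i2 := integrableRD (im (shift x e t)) (im (shift x e (- t))).
  have i3 := integrableRZ 2 (im x).
  have -> : dm S (shift x e t) e + dm S (shift x e (- t)) e - 2 * dm S x e =
      \int[P]_v h v.
    rewrite /h (RintegralB measurableT i2 i3) (RintegralD measurableT (im _) (im _)).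
    by rewrite (RintegralZl 2 measurableT (im x)).
  apply: bnd; first exact: (integrableRB i2 i3).
  move=> v; rewrite /h !mE gibbs_mean_gmean.
  exact: (gmean_pm1_even i0 (w'0 v) k1).
Qed.

Let avg_set0 (h : (E -> R) -> R) x : avg h finset.set0 x = h x.
Proof.
rewrite /avg; under eq_Rintegral do rewrite offset_set0.
by rewrite Rintegral_cst//= probability_setT mulr1.
Qed.

Let k_le1 e i : `|k i e| <= 1.
Proof. by rewrite (@pm1_norm _ _ (k^~ e)). Qed.

Let F_integrable y e (b : R) : integ (fun t => F (shift y e (t + b))).
Proof.
rewrite (funext (fun t => log_partition_shift w k y e (t + b))).
exact: (integrable_normal_lse s_gt0 i0 b (weight_gt0 k w_gt0 y) (k_le1 e)).
Qed.

Let sn0 : s != 0. Proof. by rewrite gt_eqF. Qed.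

(** Because the slopes are signs, one coupling multiplies the annealed partition function by exactly
    e^(s^2 / 2); the drift costs its relative entropy s^2 a^2 / 2. *)
Let F_integral_le y e (a : R) :
  \int[mu]_t F (shift y e (t + s ^+ 2 * a)) <= F y + s ^+ 2 / 2 + s ^+ 2 * a ^+ 2 / 2.
Proof.
rewrite (funext (fun t => log_partition_shift w k y e (t + s ^+ 2 * a))).
apply: (le_trans (gaussian_lse_le s_gt0 i0 (s ^+ 2 * a) (weight_gt0 k w_gt0 y) (k_le1 e))).
rewrite (eq_bigr (fun i => weight w k y i * expR (s ^+ 2 / 2))); last first.
  by move=> i _; rewrite k_pm1 mulr1.
rewrite -mulr_suml lnM ?posrE ?expR_gt0 ?(wtot_gt0 i0 (weight_gt0 k w_gt0 y))//.
rewrite expRK -/(F y) (_ : _ / (2 * s ^+ 2) = s ^+ 2 * a ^+ 2 / 2); last by field.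
lra.
Qed.

Let F_integral_ge z e :
  F z + s ^+ 2 / 2 + s ^+ 2 * m z e ^+ 2 / 2 - 64 * s ^+ 4 <=
  \int[mu]_t F (shift z e (t + s ^+ 2 * m z e)).
Proof.
rewrite (funext (fun t => log_partition_shift w k z e (t + s ^+ 2 * m z e))).
rewrite -[X in X + s ^+ 2 / 2](congr1 F (shift0 z e)) log_partition_shift.
rewrite gibbs_mean_gmean.
exact: (gaussian_lse_ge s_gt0 i0 s_le1 (weight_gt0 k w_gt0 z) (k_pm1^~ e)).
Qed.

(* The drift [s^2 a], [a] the mean Gibbs magnetization, is the optimal one in
   the Gaussian variational formula for [ln E exp (delta F)] as [delta -> 0]. *)
Lemma variance_le_annealed_gap S x y :
  avg F S x + \sum_f avg (m^~ f) S x * (y f - x f) +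
    (avg (fun z => F z ^+ 2) S x - avg F S x ^+ 2) / 2 <=
  F y + #|S|%:R * (s ^+ 2 / 2 + 1600 * s ^+ 4).
Proof.
rewrite -/(c S x) -/(q S x); move: x y; elim/set_ind_add : S => [|S e eS ih] x y.
  rewrite /c /q !avg_set0 subrr mul0r addr0 cards0 mul0r addr0.
  by under eq_bigr do rewrite avg_set0; exact: log_partition_tangent.
have -> : #|e |: S|%:R = #|S|%:R + 1 :> R by rewrite cardsU1 eS addnC natrD.
rewrite (mulrDl #|S|%:R 1) mul1r -/(c _ _) -/(q _ _).
set a := dm (e |: S) x e; set nS := _ * (_ + _) in ih *.
pose A t := \sum_f dm S (shift x e t) f * (y f - x f).
pose B t := 1 / 2 * (q S (shift x e t) - c S (shift x e t) ^+ 2).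
(* The extra linear term that appears because only [y] receives the drift. *)
pose D t := s ^+ 2 * a * dm S (shift x e t) e.
have ih' t : c S (shift x e t) + (A t + (B t + (D t - nS))) <=
    F (shift y e (t + s ^+ 2 * a)).
  have := ih (shift x e t) (shift y e (t + s ^+ 2 * a)).
  rewrite (_ : \sum_f _ = A t + D t); last first.
    rewrite /A /D (eq_bigr (fun f => dm S (shift x e t) f * (y f - x f) +
        (if f == e then dm S (shift x e t) f * (s ^+ 2 * a) else 0))); last first.
      move=> f _; rewrite -/(dm S _ f) /shift; case: eqP => _; ring.
    by rewrite big_split/= -big_mkcond big_pred1_eq (mulrC _ (s ^+ 2 * a)).
  by rewrite /B; lra.
have ic := c_integrable x eS; have ic2 := c2_integrable x eS.
have iq := q_integrable x eS.
have id f := dm_integrable f x eS.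
have idf f : integ (fun t => dm S (shift x e t) f * (y f - x f)).
  apply: eq_integrable (integrableRZ (y f - x f) (id f)) => // t _.
  by rewrite /= mulrC.
have iA : integ A by exact: integrableR_sum.
have iB : integ B := integrableRZ (1 / 2) (integrableRB iq ic2).
have iD : integ D := integrableRZ (s ^+ 2 * a) (id e).
have iN := integrable_cst_prob s nS.
have iDN := integrableRB iD iN; have iBDN := integrableRD iB iDN.
have iABDN := integrableRD iA iBDN.
have iall := integrableRD ic iABDN.
have h1 := le_Rintegral measurableT iall (F_integrable y e (s ^+ 2 * a)) (fun t _ => ih' t).
have {h1} := le_trans h1 (F_integral_le y e a).
rewrite (RintegralD measurableT ic iABDN) (RintegralD measurableT iA iBDN).
rewrite (RintegralD measurableT iB iDN) (RintegralB measurableT iD iN).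
rewrite (RintegralZl (1 / 2) measurableT (integrableRB iq ic2)).
rewrite (RintegralB measurableT iq ic2) (RintegralZl (s ^+ 2 * a) measurableT (id e)).
rewrite Rintegral_cst_prob -(proj2 (c_step x eS)) -(proj2 (q_step x eS)).
rewrite -(proj2 (dm_step e x eS)) -/a.
have -> : \int[mu]_t A t = \sum_f dm (e |: S) x f * (y f - x f).
  rewrite (Rintegral_sum (index_enum E) idf); apply: eq_bigr => f _.
  by rewrite (RintegralZr (y f - x f) measurableT (id f)) -(proj2 (dm_step f x eS)).
(* By the law of total variance, half the variance grows by at most s^2 a^2 / 2 + 1600 s^4. The term
   [D] integrates to s^2 a^2, which pays for this s^2 a^2 / 2 and for the equal cost of the
   drift. *)
have := c_variance x eS; rewrite -/a.
set V := \int[mu]_t _; set C := c _ _; set Q := q _ _; set SS := \sum_f _.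
rewrite -/SS.
move=> h1 h2; lra.
Qed.

(** Summed over pairs of replicas, this is the second moment of Z at [y] with Gaussian couplings
    added on [S]: one coupling contributes exp (s^2 (k + k')^2 / 2) = exp (s^2 (1 + k k')). *)
Definition pair_weight S y (p : I * I) :=
  w p.1 * w p.2 * expR (energy k y p.1 + energy k y p.2 +
                        s ^+ 2 * \sum_(e in S) (1 + k p.1 e * k p.2 e)).

Definition log_pair_partition S y := ln (\sum_p pair_weight S y p).

Lemma pair_weight_gt0 S y p : 0 < pair_weight S y p.
Proof. by rewrite !mulr_gt0 ?expR_gt0. Qed.

Lemma log_pair_partition_shift S y e t :
  log_pair_partition S (shift y e t) =
  lse (pair_weight S y) (fun p => k p.1 e + k p.2 e) t.
Proof.
congr ln; apply: eq_bigr => p _; rewrite /pair_weight !energy_shift -[RHS]mulrA.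
by rewrite -expRD; congr (_ * expR _); ring.
Qed.

(** The drift r s^2 a is doubled at r = 2; its entropy (2 s^2 a)^2 / (2 s^2) is 2 s^2 a^2. *)
Let pair_step S y e (a : R) : e \notin S ->
  \int[mu]_t log_pair_partition S (shift y e (t + 2 * (s ^+ 2 * a))) <=
  log_pair_partition (e |: S) y + 2 * (s ^+ 2 * a ^+ 2).
Proof.
move=> eS.
rewrite (funext (fun t => log_pair_partition_shift S y e (t + 2 * (s ^+ 2 * a)))).
have k2 (p : I * I) : `|k p.1 e + k p.2 e| <= 2.
  by rewrite (le_trans (ler_normD _ _))// (_ : 2 = 1 + 1) ?lerD.
apply: (le_trans (gaussian_lse_le s_gt0 (i0, i0) (2 * (s ^+ 2 * a))
  (pair_weight_gt0 S y) k2)).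
rewrite (eq_bigr (pair_weight (e |: S) y)); last first.
  move=> p _; rewrite /pair_weight -[LHS]mulrA -expRD; congr (_ * expR _).
  have -> : s ^+ 2 * (k p.1 e + k p.2 e) ^+ 2 / 2 = s ^+ 2 * (1 + k p.1 e * k p.2 e).
    by rewrite sqrrD !k_pm1; field.
  by rewrite big_setU1//=; ring.
rewrite -/(log_pair_partition _ _) addrC lerD2l.
by rewrite [leLHS](_ : _ = 2 * (s ^+ 2 * a ^+ 2))//; field.
Qed.

(** Midpoint convexity between r = 0 at [x], r = 1 at [z] and r = 2 at [2 z - x]. The drifts 0, s^2
    a and 2 s^2 a keep [z] the midpoint, and the drift terms s^2 a^2 / 2 and 2 s^2 a^2 / 4 cancel.
    Only the loss of the one-coupling lower bound remains. *)
Lemma annealed_gap_le S x z :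
  F z + #|S|%:R * (s ^+ 2 / 2) <=
  log_pair_partition S (fun f => 2 * z f - x f) / 4 + avg F S x / 2 +
  #|S|%:R * (64 * s ^+ 4).
Proof.
move: x z; elim/set_ind_add : S => [|S e eS ih] x z.
  rewrite avg_set0 cards0 !mul0r !addr0.
  set y := (X in log_pair_partition _ X).
  have -> : log_pair_partition finset.set0 y = 2 * F y.
    rewrite mulr_natl -lnXn ?(wtot_gt0 i0 (weight_gt0 k w_gt0 y))//.
    congr ln; rewrite expr2 big_distrlr/= pair_bigA/=.
    apply: eq_bigr => p _; rewrite /pair_weight big_set0 mulr0 addr0 expRD.
    by rewrite mulrACA.
  (* As [z] is the midpoint of [x] and [y], the gradient terms of the two tangents at [z] cancel. *)
  have h1 := log_partition_tangent k i0 w_gt0 z y.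
  have h2 := log_partition_tangent k i0 w_gt0 z x.
  have : \sum_f m z f * (y f - z f) + \sum_f m z f * (x f - z f) = 0.
    by rewrite -big_split big1// => f _; rewrite /y/=; ring.
  move=> h3; lra.
have -> : #|e |: S|%:R = #|S|%:R + 1 :> R by rewrite cardsU1 eS addnC natrD.
rewrite !(mulrDl #|S|%:R 1) !mul1r.
set nS := _ * (s ^+ 2 / 2) in ih *; set nK := _ * (64 * _) in ih *.
set y := (X in log_pair_partition _ X); set a := m z e.
have ic := c_integrable x eS.
have k2 (p : I * I) : `|k p.1 e + k p.2 e| <= 2.
  by rewrite (le_trans (ler_normD _ _))// (_ : 2 = 1 + 1) ?lerD.
pose U t := log_pair_partition S (shift y e (t + 2 * (s ^+ 2 * a))).
have iU : integ U.
  rewrite /U (funext (fun t => log_pair_partition_shift S y e (t + 2 * (s ^+ 2 * a)))).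
  exact: (integrable_normal_lse s_gt0 (i0, i0) _ (pair_weight_gt0 S y) k2).
have ih' t : F (shift z e (t + s ^+ 2 * a)) <=
    (nK - nS) + (1 / 4 * U t + 1 / 2 * c S (shift x e t)).
  have := ih (shift x e t) (shift z e (t + s ^+ 2 * a)).
  rewrite (_ : (fun f => _) = shift y e (t + 2 * (s ^+ 2 * a))); last first.
    by apply/funext => f; rewrite /shift /y; case: eqP => _; ring.
  by rewrite -/(U t) -/(c S _); lra.
have iN := integrable_cst_prob s (nK - nS).
have i1 := integrableRZ (1 / 4) iU; have i2 := integrableRZ (1 / 2) ic.
have i12 := integrableRD i1 i2.
have h1 := le_Rintegral measurableT (F_integrable z e (s ^+ 2 * a))
  (integrableRD iN i12) (fun t _ => ih' t).
have {h1} := le_trans (F_integral_ge z e) h1; rewrite -/a.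
rewrite (RintegralD measurableT iN i12) (RintegralD measurableT i1 i2).
rewrite (RintegralZl (1 / 4) measurableT iU) (RintegralZl (1 / 2) measurableT ic).
rewrite Rintegral_cst_prob -(proj2 (c_step x eS)).
have := pair_step y a eS; rewrite -/(c _ _).
set V := \int[mu]_t _ => h1; rewrite -/V.
set C := c _ _; set L := log_pair_partition _ _ in h1 *; set Fz := F z.
move=> h2; lra.
Qed.

(* [variance_le_annealed_gap] at [x = y = 0] bounds the variance by twice the
   gap between annealed and quenched free energies, and [annealed_gap_le] bounds
   that gap by half the logarithm of the normalized second moment. *)
Lemma log_partition_variance_le : \sum_i w i = 1 ->
  \int[P]_v (F (fun f => g f v) ^+ 2) - (\int[P]_v F (fun f => g f v)) ^+ 2 <=
  ln (\sum_i \sum_j w i * w j * expR (s ^+ 2 * \sum_e k i e * k j e)) +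
  3500 * (#|E|%:R * s ^+ 4).
Proof.
move=> w1; pose o : E -> R := fun=> 0.
have h1 : avg F finset.setT o +
    (avg (fun z => F z ^+ 2) finset.setT o - avg F finset.setT o ^+ 2) / 2 <=
    F o + #|E|%:R * (s ^+ 2 / 2 + 1600 * s ^+ 4).
  have := variance_le_annealed_gap finset.setT o o.
  by rewrite cardsT big1 ?addr0// => f _; rewrite subrr mulr0.
have := annealed_gap_le finset.setT o o; rewrite cardsT; move: h1.
have avgT (h : (E -> R) -> R) : avg h finset.setT o = \int[P]_v h (fun f => g f v).
  by rewrite /avg; under eq_Rintegral do rewrite offset_setT.
rewrite !avgT.
have en0 i : energy k o i = 0 by apply: big1 => e _; rewrite mul0r.
have -> : F o = 0.
  rewrite /log_partition (eq_bigr w) ?w1 ?ln1// => i _.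
  by rewrite /weight en0 expR0 mulr1.
have -> : log_pair_partition finset.setT (fun f => 2 * o f - o f) =
    s ^+ 2 * #|E|%:R +
    ln (\sum_i \sum_j w i * w j * expR (s ^+ 2 * \sum_e k i e * k j e)).
  have o2 : (fun f => 2 * o f - o f) = o.
    by apply/funext => f; rewrite /o mulr0 subr0.
  rewrite o2 -[X in X + _]expRK -lnM ?posrE ?expR_gt0//; last first.
    rewrite (bigD1 i0)//= ltr_wpDr//.
      by do 2 (apply: sumr_ge0 => ? _); rewrite !mulr_ge0 ?expR_ge0// ltW.
    rewrite (bigD1 i0)//= ltr_wpDr//.
      by apply: sumr_ge0 => ? _; rewrite !mulr_ge0 ?expR_ge0// ltW.
    by rewrite !mulr_gt0 ?expR_gt0.
  congr ln; rewrite mulr_sumr.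
  under [RHS]eq_bigr do rewrite mulr_sumr.
  rewrite pair_bigA/=; apply: eq_bigr => p _.
  rewrite /pair_weight !en0 !add0r [RHS]mulrCA -expRD; congr (_ * expR _).
  rewrite big_split/= sumr_const cardsT -mulr_natr mul1r mulrDr; congr (_ + _ * _).
  by apply: eq_bigl => e; rewrite inE.
set V := \int[P]_v _; set M := \int[P]_v _; set L := ln _; set n := #|E|%:R.
(* The accumulated error is 2 * 1600 + 4 * 64 = 3456 times [n * s ^+ 4]. *)
have s4 : 0 <= n * s ^+ 4 by rewrite mulr_ge0 ?exprn_ge0// ltW.
lra.
Qed.

End disorder.

(** * The Sherrington-Kirkpatrick model *)

Section edges.
Context {R : realType} (N : nat).
Implicit Type a : 'I_N -> R.

Lemma sum_edge (h : 'I_N * 'I_N -> R) :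
  \sum_(e : edge N) h (val e) = \sum_(p : 'I_N * 'I_N | (p.1 < p.2)%N) h p.
Proof. exact/esym/(big_sub [pred p : 'I_N * 'I_N | (p.1 < p.2)%N]). Qed.

Lemma sqr_sum_edge a : (\sum_i a i) ^+ 2 =
  \sum_i a i ^+ 2 + 2 * \sum_(e : edge N) a (val e).1 * a (val e).2.
Proof.
rewrite (sum_edge (fun p => a p.1 * a p.2)) expr2 big_distrlr/=.
have swap : \sum_(p : 'I_N * 'I_N | (p.2 < p.1)%N) a p.1 * a p.2 =
            \sum_(p : 'I_N * 'I_N | (p.1 < p.2)%N) a p.1 * a p.2.
  have sinj : injective (fun p : 'I_N * 'I_N => (p.2, p.1)).
    by move=> [? ?] [? ?] [-> ->].
  by rewrite (reindex_inj sinj)/=; apply: eq_bigr => p _; exact: mulrC.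
have diag : \sum_(p : 'I_N * 'I_N | p.1 == p.2) a p.1 * a p.2 = \sum_i a i ^+ 2.
  rewrite big_mkcond -(pair_bigA _ (fun i j => if i == j then a i * a j else 0))/=.
  apply: eq_bigr => i _; rewrite (bigD1 i)//= eqxx big1 ?addr0 ?expr2// => j.
  by rewrite eq_sym => /negbTE ->.
rewrite -diag mulr_natl mulr2n -[X in _ = _ + (X + _)]swap pair_bigA/=.
rewrite big_mkcond [X in _ = _ + (X + _)]big_mkcond [X in _ = _ + (_ + X)]big_mkcond.
rewrite [X in _ = X + _]big_mkcond -!big_split/=.
apply: eq_bigr => -[i j] _ /=; rewrite -val_eqE/=.
by case: ltngtP => _; rewrite ?addr0 ?add0r.
Qed.

Lemma card_edge_le : (#|edge N| <= N ^ 2)%N.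
Proof.
by rewrite card_sig (leq_trans (max_card _))// card_prod !card_ord.
Qed.

Lemma spinM (b b' : bool) : spin R b * spin R b' = spin R (b (+) b').
Proof. by rewrite /spin signr_addb. Qed.

Lemma sqr_spin (b : bool) : spin R b ^+ 2 = 1.
Proof. by rewrite /spin sqrr_sign. Qed.

End edges.

Lemma variance_Rintegral d (T : measurableType d) (R : realType)
    (P : probability T R) (f : T -> R) :
  P.-integrable setT (EFin \o f) ->
  P.-integrable setT (EFin \o (fun x => f x ^+ 2)) ->
  ('V_P[f] = (\int[P]_x (f x ^+ 2) - (\int[P]_x f x) ^+ 2)%:E)%E.
Proof.
move=> i1 i2; have l1 : f \in Lfun P 1 by apply/Lfun1_integrable.
have l2 : (f * f)%R \in Lfun P 1 by apply/Lfun1_integrable.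
rewrite /variance covarianceE// unlock -expe2.
have E1 : (\int[P]_x (f x)%:E = (\int[P]_x f x)%:E)%E.
  by rewrite fineK//; exact: integrable_fin_num i1.
have E2 : (\int[P]_x ((f * f) x)%:E = (\int[P]_x (f x ^+ 2))%:E)%E.
  by rewrite fineK//; exact: integrable_fin_num i2.
by rewrite E1 E2.
Qed.

(** * Overlaps of two replicas *)

Section spin_overlap.
Context {R : realType} (N : nat).
Local Notation config := {ffun 'I_N -> bool}.

Definition edge_spin (s : config) (e : edge N) : R :=
  spin R (s (val e).1) * spin R (s (val e).2).

(** Gauge symmetry: multiplying [s'] sitewise by [s] is an involution of the configurations that
    turns products of edge spins into the edge spins of one configuration. *)
Lemma sum_pair_spin (h : (edge N -> R) -> R) :
  \sum_(s : config) \sum_(s' : config) h (fun e => edge_spin s e * edge_spin s' e) =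
  2 ^+ N * \sum_(s : config) h (edge_spin s).
Proof.
have inner (s : config) :
    \sum_(s' : config) h (fun e => edge_spin s e * edge_spin s' e) =
    \sum_(s' : config) h (edge_spin s').
  pose phi (s' : config) : config := [ffun i => s i (+) s' i].
  have phiK : involutive phi by move=> s'; apply/ffunP => i; rewrite !ffunE addKb.
  rewrite (reindex_inj (inv_inj phiK))/=; apply: eq_bigr => s' _; congr h.
  apply/funext => e; rewrite /edge_spin !ffunE -!spinM.
  rewrite [LHS](_ : _ = spin R (s (val e).1) ^+ 2 * spin R (s (val e).2) ^+ 2 *
     (spin R (s' (val e).1) * spin R (s' (val e).2))); last by ring.
  by rewrite !sqr_spin !mul1r.
rewrite (eq_bigr _ (fun s _ => inner s)) sumr_const card_ffun card_bool card_ord.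
by rewrite -[LHS]mulr_natl natrX.
Qed.

Lemma ln_sum_overlap_le : (0 < N)%N ->
  ln (\sum_(s : config) \sum_(s' : config) (2 ^+ N)^-1 * (2 ^+ N)^-1 *
        expR (N%:R^-1 * \sum_e edge_spin s e * edge_spin s' e))
  <= 4^-1 * ln N%:R + 5.
Proof.
move=> N0; apply: le_trans (ln_sum_expR_spin_square N0).
have p2 : 0 < 2 ^+ N :> R by rewrite exprn_gt0.
rewrite (sum_pair_spin (fun u => (2 ^+ N)^-1 * (2 ^+ N)^-1 * expR (N%:R^-1 * \sum_e u e))).
rewrite -mulr_sumr -mulrA mulVKf ?gt_eqF//.
have pos (h : config -> R) : 0 < (2 ^+ N)^-1 * \sum_s expR (h s).
  rewrite mulr_gt0 ?invr_gt0// (bigD1 [ffun=> false])//= ltr_pwDl ?expR_gt0//.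
  by apply: sumr_ge0 => i _; exact: expR_ge0.
rewrite ler_ln ?posrE// ler_pM2l ?invr_gt0//; apply: ler_sum => s _.
rewrite ler_expR; have n0 : 0 < N%:R :> R by rewrite ltr0n.
rewrite (sqr_sum_edge (fun i => spin R (s i))).
have -> : (\sum_i spin R (s i) ^+ 2 + 2 * \sum_(e : edge N) spin R (s (val e).1) *
    spin R (s (val e).2)) / (2 * N%:R) =
   (2 * N%:R)^-1 * \sum_i spin R (s i) ^+ 2 + N%:R^-1 * \sum_e edge_spin s e.
  by rewrite /edge_spin; field; rewrite gt_eqF.
rewrite lerDr mulr_ge0//.
by apply: sumr_ge0 => i _; exact: sqr_ge0.
Qed.

End spin_overlap.

Theorem theorem1 (R : realType) :
  exists C : R, 0 < C /\
    forall (N : nat), (1 <= N)%N ->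
    forall (d : measure_display) (T : measurableType d) (P : probability T R)
      (g : edge N -> {RV P >-> R}),
      (forall e, centered_gaussian (N%:R^-1) (g e)) ->
      mutually_independent g ->
      ('V_P[fun w : T => free_energy 1 (fun e => g e w)]
        <= (4^-1 * ln (N%:R) + C)%:E)%E.
Proof.
(* This covers 5 from the second moment and 3500 from the accumulated errors. *)
exists 4000; split; first by rewrite ltr0n.
move=> N N1 d T P g g_law g_indep.
have n0 : 0 < N%:R :> R by rewrite ltr0n.
pose s : R := Num.sqrt N%:R^-1.
have s0 : 0 < s by rewrite sqrtr_gt0 invr_gt0.
have s2 : s ^+ 2 = N%:R^-1 by rewrite sqr_sqrtr// invr_ge0 ltW.
have s1 : s <= 1.
  by rewrite -(@ler_pXn2r _ 2) ?nnegrE ?(ltW s0)// s2 expr1n invf_le1// ler1n.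
pose w (i : {ffun 'I_N -> bool}) : R := (2 ^+ N)^-1.
have w0 i : 0 < w i by rewrite invr_gt0 exprn_gt0.
have w1 : \sum_i w i = 1.
  rewrite sumr_const card_ffun card_bool card_ord -[LHS]mulr_natr natrX.
  by rewrite mulVf ?gt_eqF ?exprn_gt0.
have k1 (i : {ffun 'I_N -> bool}) e : @edge_spin R N i e ^+ 2 = 1.
  by rewrite /edge_spin exprMn !sqr_spin mulr1.
have FE x : log_partition w (@edge_spin R N) x = free_energy 1 x.
  rewrite /free_energy /partition_function mulr_sumr; congr ln.
  apply: eq_bigr => i _; congr (_ * expR _); rewrite mul1r.
  by apply: eq_bigr => e _; rewrite mulrA.
pose i0 : {ffun 'I_N -> bool} := [ffun=> false].
have offE v : offset g (fun=> 0) finset.setT v = fun f => g f v by exact: offset_setT.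
have i1 := integrable_log_partition i0 w0 k1 s0 g_law finset.setT (fun=> 0).
have i2 := integrable_log_partition2 i0 w0 k1 s0 g_law finset.setT (fun=> 0).
rewrite variance_Rintegral; last 2 first.
- by apply: eq_integrable i1 => // v _; rewrite /= offE FE.
- by apply: eq_integrable i2 => // v _; rewrite /= offE FE.
rewrite lee_fin.
have := log_partition_variance_le i0 w0 k1 s0 s1 g_law g_indep w1.
under eq_Rintegral do rewrite FE.
under [X in _ - X ^+ 2]eq_Rintegral do rewrite FE.
move=> /le_trans; apply.
have := ln_sum_overlap_le N1 (R := R); rewrite -s2 /w.
(* At most N^2 edges, each with s^4 = N^-2. *)
have : #|edge N|%:R * s ^+ 4 <= 1.
  rewrite (exprM _ 2 2) s2 exprVn ler_pdivrMr ?exprn_gt0// mul1r -natrX ler_nat.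
  exact: card_edge_le.
lra.
Qed.
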